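(* Let $X\subseteq\{1,2,3\}^{\mathbb N}$ and $Y\subseteq\{1,2\}^{\mathbb N}$ be irreducible shifts of finite type such that $Y$ is the full shift or has transition matrix $\begin{pmatrix}0&1\\1&1\end{pmatrix}$. Let $\pi:X\to Y$ be a one-block factor map with $\pi(1)=1$, $\pi(2)=\pi(3)=2$. Let $f:X\to\mathbb R$ be a function of two coordinates, let $\mathcal G=\{\log g_n\}_{n=1}^\infty$ be the sequence on $Y$ associated to the relative pressure function $P(\sigma_X,\pi,f)$, and let $\mu$ be an invariant Gibbs measure for $f$. Let $M$ and $M_{22}\vert_{\pi^{-1}(22)}$ be the matrices associated with $f$. Then the following hold. (i) The sequence $\mathcal G$ is almost additive on $Y$ if and only if there exists a Borel measurable function $\hat g$ on $Y$ for which $\pi\mu$ is the unique invariant Gibbs measure. If $\mathcal G$ is merely weakly almost additive on $Y$, then there exists a Borel measurable function $\hat g$ on $Y$ for which $\pi\mu$ is the unique invariant weak Gibbs measure. (ii) If $M_{22}\vert_{\pi^{-1}(22)}$ is not of the form $\begin{pmatrix}0 & a_1 \\ a_2 & 0\end{pmatrix}$ with $a_1,a_2>0$, then (i) holds for a function $\hat g\in C(Y)$; that is, $\mathcal G$ is almost additive if and only if there exists $\hat g\in C(Y)$ for which $\pi\mu$ is the unique invariant Gibbs measure, and if $\mathcal G$ is merely weakly almost additive, then there exists $\hat g\in C(Y)$ for which $\pi\mu$ is the unique invariant weak Gibbs measure. (iii) If $M_{22}\vert_{\pi^{-1}(22)}=\begin{pmatrix}0 & a_1 \\ a_1 & 0\end{pmatrix}$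 for some $a_1>0$, and $M$ satisfies $M(2,1)=M(3,1)$ or $M(1,2)=M(1,3)$, then (i) holds for a function $\hat g\in C(Y)$ (in the same sense as in (ii)).
   Context: For a $k\times k$ zero-one matrix $A=(a_{ij})$, the shift of finite type with transition matrix $A$ is $X_A=\{x\in\{1,\dots,k\}^{\mathbb N}:a_{x_nx_{n+1}}=1\ \forall n\}$ with the shift $(\sigma x)_i=x_{i+1}$. A subshift $X$ is irreducible if for all allowable words $u,v\in B(X)$ there is $w\in B(X)$ with $uwv\in B(X)$; here $B_n(X)$ is the set of $n$-blocks of $X$, $B(X)=\bigcup_{n\ge0}B_n(X)$ and $[x_1\dots x_n]$ denotes a cylinder set. A factor map $\pi:X\to Y$ is a continuous surjection with $\pi\circ\sigma_X=\sigma_Y\circ\pi$; it is one-block if $(\pi(x))_i=\pi(x_i)$ for a map $\pi$ on symbols, also applied to words letterwise. $M(X,\sigma_X)$ is the set of $\sigma_X$-invariant Borel probability measures, $\pi\mu(B)=\mu(\pi^{-1}B)$, and $S_ng=\sum_{i=0}^{n-1}g\circ\sigma^i$. $f$ is a function of two coordinates if $f(x)$ depends only on $x_1x_2$; write $f[ij]=f(x)$ for $x\in[ij]$. With $A=(a_{ij})$ the $3\times3$ transition matrix of $X$, $M$ is the $3\times 3$ matrix with entries $M(i,j)=e^{f[ij]}a_{ij}$ (zero if $a_{ij}=0$), and $M_{22}\vert_{\pi^{-1}(22)}=(M(i,j))_{i,j\in\{2,3\}}$. For $y\in Y$ and $n\in\mathbb N$, $g_n(y)=\sup_{E_n(y)}\sum_{x\in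 E_n(y)}e^{(S_nf)(x)}$, where the supremum is over all sets $E_n(y)$ consisting of exactly one point from each cylinder $[x_1\dots x_n]$ of $X$ with $\pi(x_1\dots x_n)=y_1\dots y_n$. The sequence $\mathcal G=\{\log g_n\}_{n\ge1}$ on $Y$ is called the sequence associated to the relative pressure function $P(\sigma_X,\pi,f)$. A sequence $\{\log f_n\}$ of continuous functions ($f_n>0$) on a subshift is almost additive if there is $C>0$ with $e^{-C}f_n(y)f_m(\sigma^ny)\le f_{n+m}(y)\le e^Cf_n(y)f_m(\sigma^ny)$ for all points $y$ and $n,m\in\mathbb N$; weakly almost additive if there are $C_n>0$ with $C_n/n\to0$ such that this holds with $C$ replaced by $C_n$. For a Borel measurable function $g$, an invariant probability measure $\mu$ is a weak Gibbs measure for $g$ if there are $P\in\mathbb R$ and $C_n>0$ with $\frac1n\log C_n\to0$ such that $\frac1{C_n}\le\mu[x_1\dots x_n]/e^{-nP+(S_ng)(x)}\le C_n$ for all $x$ and $n$; it is a Gibbs measure for $g$ if one can take $C_n=C$ for all $n$. *)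

(* Defs.v *)
(* Sequences are indexed from 0: the coordinate x_i is [x (i - 1)], and the
   symbol i of {1, ..., k} is the ordinal of value i - 1. *)
From HB Require Import structures.
From mathcomp Require Import all_boot all_order all_algebra.
From mathcomp Require Import all_classical all_reals all_analysis.

Set Implicit Arguments.
Unset Strict Implicit.
Unset Printing Implicit Defensive.

Import Order.TTheory GRing.Theory Num.Theory.
Import numFieldNormedType.Exports.

Local Open Scope classical_set_scope.
Local Open Scope ring_scope.

HB.instance Definition _ k := isPointed.Build 'I_k.+1 ord0.

(* [seq_space k] has k + 1 symbols, so that it is nonempty. *)
Definition seq_space (k : nat) : Type :=
  prod_topology (fun _ : nat => discrete_topology 'I_k.+1).

HB.instance Definition _ k := Pointed.on (seq_space k).
HB.instance Definition _ k := Nbhs.on (seq_space k).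
HB.instance Definition _ k := Topological.on (seq_space k).
HB.instance Definition _ k :=
  Measurable.copy (seq_space k) (g_sigma_algebraType (@open (seq_space k))).

Section Shifts.
Variable k : nat.
Implicit Types (x : seq_space k) (X : set (seq_space k)) (w : seq 'I_k.+1).

Definition shift x : seq_space k := fun i => x i.+1.

Definition word x (i n : nat) : seq 'I_k.+1 := mkseq (fun j => x (i + j)%N) n.

Definition sft (A : 'M[bool]_k.+1) : set (seq_space k) :=
  [set x | forall n, A (x n) (x n.+1)].

Definition blocks X (n : nat) : set (seq 'I_k.+1) :=
  [set w | exists2 x, X x & exists i, w = word x i n].

Definition language X : set (seq 'I_k.+1) := \bigcup_n blocks X n.

Definition irreducible X : Prop :=
  forall u v, language X u -> language X v ->
    exists2 w, language X w & language X (u ++ w ++ v).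

Definition cylinder X w : set (seq_space k) :=
  [set x | X x /\ word x 0 (size w) = w].

End Shifts.

Definition one_block k l (p : 'I_k.+1 -> 'I_l.+1) (x : seq_space k) :
  seq_space l := fun i => p (x i).

Definition factor_map k l (X : set (seq_space k)) (Y : set (seq_space l))
    (pi : seq_space k -> seq_space l) : Prop :=
  [/\ {within X, continuous pi}, pi @` X = Y &
      forall x, X x -> pi (shift x) = shift (pi x)].

Lemma coord_continuous k (i : nat) :
  continuous (fun x : seq_space k => x i : discrete_topology 'I_k.+1).
Proof. exact: (@proj_continuous nat (fun=> discrete_topology 'I_k.+1) i). Qed.

Lemma seq_space_continuous (S : topologicalType) k (f : S -> seq_space k) :
  (forall i, continuous (fun x => f x i : discrete_topology 'I_k.+1)) ->
  continuous f.
Proof.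
move=> fc x; apply/cvg_sup => i U [_ [[V oV <-] Vfx] VU].
by apply: filterS VU _; apply: (fc i x V); exact: open_nbhs_nbhs.
Qed.

Lemma one_block_continuous k l (p : 'I_k.+1 -> 'I_l.+1) :
  continuous (one_block p).
Proof.
apply: seq_space_continuous => i x U pU.
apply: (@coord_continuous k i x (p @^-1` U)).
move: pU; rewrite !nbhs_principalE.
by move=> /principal_filterP pU; apply/principal_filterP.
Qed.

Lemma one_block_measurable k l (p : 'I_k.+1 -> 'I_l.+1) :
  measurable_fun setT (one_block p).
Proof.
apply: (@measurability _ _ _ _ _ _ (@open (seq_space l))) => //.
move=> _ [U oU <-]; rewrite setTI; apply: sub_sigma_algebra.
by move: oU; apply: (continuousP _).1; exact: one_block_continuous.
Qed.

HB.instance Definition _ k l (p : 'I_k.+1 -> 'I_l.+1) :=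
  isMeasurableFun.Build _ _ _ _ (one_block p) (one_block_measurable p).

Section Potentials.
Variables (R : realType) (k : nat).
Local Notation T := (seq_space k).
Implicit Types (X : set T) (f g : T -> R).

Definition birkhoff g (n : nat) (x : T) : R :=
  \sum_(0 <= i < n) g (iter i (@shift k) x).

Definition two_coordinates X f : Prop :=
  forall x y, X x -> X y -> x 0%N = y 0%N -> x 1%N = y 1%N -> f x = f y.

(* The value f[ij], well defined when [f] is a function of two coordinates and
   the cylinder [ij] of [X] is nonempty. *)
Definition value2 X f (i j : 'I_k.+1) : R :=
  f (xget point (cylinder X [:: i; j])).

Definition weight_mx (A : 'M[bool]_k.+1) f : 'M[R]_k.+1 :=
  \matrix_(i, j) (expR (value2 (sft A) f i j) * (A i j)%:R).

(* Measures on [X] are the measures on the whole sequence space carried by [X];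
   similarly a function on [X] is only constrained through its values on [X]. *)
Definition shift_invariant X (mu : probability T R) : Prop :=
  mu X = 1%E /\
  forall B, measurable B -> mu (@shift k @^-1` B) = mu B.

Definition gibbs_bounds X g (mu : probability T R) (P : R) (C : nat -> R) :=
  forall x n, X x -> (0 < n)%N ->
    (C n)^-1 <= fine (mu (cylinder X (word x 0 n)))
                / expR (- (n%:R * P) + birkhoff g n x) <= C n.

Definition gibbs X g (mu : probability T R) : Prop :=
  exists P C, 0 < C /\ gibbs_bounds X g mu P (fun=> C).

Definition weak_gibbs X g (mu : probability T R) : Prop :=
  exists P C, [/\ forall n, (0 < n)%N -> 0 < C n,
    (fun n => ln (C n) / n%:R) @ \oo --> (0 : R) & gibbs_bounds X g mu P C].

Definition unique_invariant X (G : probability T R -> Prop)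
    (mu : probability T R) : Prop :=
  [/\ shift_invariant X mu, G mu &
      forall nu, shift_invariant X nu -> G nu ->
        forall B, measurable B -> nu B = mu B].

(* Below, [F] stands for the sequence of potentials (log (F n))_(n >= 1); the
   value [F 0] is irrelevant. *)
Definition positive_continuous X (F : nat -> T -> R) : Prop :=
  forall n, (0 < n)%N ->
    {within X, continuous (F n)} /\ forall x, X x -> 0 < F n x.

Definition additive_bounds X (F : nat -> T -> R) (C : nat -> R) : Prop :=
  forall x n m, X x -> (0 < n)%N -> (0 < m)%N ->
    expR (- C n) * (F n x * F m (iter n (@shift k) x)) <= F (n + m)%N x
      <= expR (C n) * (F n x * F m (iter n (@shift k) x)).

Definition almost_additive X (F : nat -> T -> R) : Prop :=
  positive_continuous X F /\
  exists2 C, 0 < C & additive_bounds X F (fun=> C).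

Definition weakly_almost_additive X (F : nat -> T -> R) : Prop :=
  positive_continuous X F /\
  exists C, [/\ forall n, (0 < n)%N -> 0 < C n,
    (fun n => C n / n%:R) @ \oo --> (0 : R) & additive_bounds X F C].

End Potentials.

Section RelativePressure.
Variables (R : realType) (k l : nat) (X : set (seq_space k)).
Variables (p : 'I_k.+1 -> 'I_l.+1) (f : seq_space k -> R).

(* [E] consists of exactly one point from each cylinder [x_1 ... x_n] of [X]
   with p (x_1 ... x_n) = y_1 ... y_n. *)
Definition selector (n : nat) (y : seq_space l) (E : set (seq_space k)) :=
  (forall x, E x -> X x /\ map p (word x 0 n) = word y 0 n) /\
  (forall w, blocks X n w -> map p w = word y 0 n ->
     exists! x, E x /\ cylinder X w x).

(* The sets [E] are finite, so [\sum_(x \in E)] is the actual sum. *)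
Definition relative_g (n : nat) (y : seq_space l) : R :=
  sup [set \sum_(x \in E) expR (birkhoff f n x) | E in selector n y].

End RelativePressure.

(* The two assertions relating the sequence (log (F n)) on [Y] to [nu], with
   the potential of the (weak) Gibbs measure taken in the class [cls]. *)
Definition gibbs_assertion (R : realType) k (Y : set (seq_space k))
    (F : nat -> seq_space k -> R) (nu : probability (seq_space k) R)
    (cls : (seq_space k -> R) -> Prop) : Prop :=
  (almost_additive Y F <->
     exists2 g, cls g & unique_invariant Y (gibbs Y g) nu) /\
  (weakly_almost_additive Y F ->
     exists2 g, cls g & unique_invariant Y (weak_gibbs Y g) nu).

Definition golden_mx : 'M[bool]_2 :=
  \matrix_(i, j) ~~ ((i == ord0) && (j == ord0)).

Definition sub22 (R : Type) (M : 'M[R]_3) : 'M[R]_2 :=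
  mxsub (lift ord0) (lift ord0) M.

Definition antidiag_mx (R : realType) (a b : R) : 'M[R]_2 :=
  \matrix_(i, j) (if i == j then 0 else if i == ord0 then a else b).

(* Main.v *)
Require Import Defs.
From mathcomp Require Import all_boot all_order all_algebra.
From mathcomp Require Import all_classical all_reals all_analysis.
From mathcomp Require Import ring lra zify.

(** The idea is to work with the measures of words.  Write [nu] for the image of
    [mu] and [1], [2] for the symbols of [Y].  By the Gibbs property of [mu], the
    function [g_n] of the relative pressure is comparable to [expR (n * P)] times
    the [nu]-measure of the word read ([relative_g_bounds]).  So the (weak) almost
    additivity of the sequence is a quasi-Bernoulli property of [nu], which every
    Gibbs measure has; this gives one implication ([gibbs_almost_additive]).

    For the other one, [mu] is a Markov measure ([gibbs_markov]), and since the
    symbol [1] of [Y] has a single preimage, [nu] has a renewal structure at [1]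
    ([factor_renewal]).  Hence the conditional probability under [nu] of the first
    symbol given the later ones depends only on the position of the next [1], and
    its logarithm is the potential sought ([factor_potential]).  Its Birkhoff sums
    telescope to logarithms of ratios of measures of words, which the
    quasi-Bernoulli property compares with the measure of the word read
    ([factor_potential_bound]).

    Its continuity is in doubt only at the two points that read [2] from the second
    symbol on.  The measures [e_j] of the words made of a run of [2] closed by [1]
    satisfy a linear recurrence of order two, whose coefficients are the trace and
    the determinant of the transitions within the fibre of [2]
    ([block_recurrence]).  If the trace
    is positive, the ratios [e_(j+1) / e_j] converge ([recurrence_ratio_cvg]) and
    the potential is continuous.  The trace vanishes exactly in the antidiagonal
    case; then [e_(j+2) / e_j] is constant, which is enough for the bounds, and the
    symmetry assumed in the last assertion makes [e_(j+1) / e_j] constant too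
    ([antidiag_block_geometric]).

    Both the Markov property of [mu] and the uniqueness of the (weak) Gibbs measure
    follow from one principle ([rigidity]): if the relative entropy of an invariant
    measure with respect to a law on words that is stationary to the left grows
    sublinearly in the length, then both have the same conditional probabilities
    of a letter given the letters after it, whenever these depend, under the law,
    on finitely many letters only.  For [mu] the law comes from a left
    invariant vector of the matrix of weights.  For uniqueness the law is [nu]; a
    weak Gibbs measure with the same potential is then proportional to [nu] on the
    words ending with [1], and the exponential decay of the measures of the runs of
    [2] shows that the factor is one. *)

Set Implicit Arguments.
Unset Strict Implicit.
Unset Printing Implicit Defensive.

Import Order.TTheory GRing.Theory Num.Theory.
Import numFieldNormedType.Exports.

Local Open Scope classical_set_scope.
Local Open Scope ring_scope.

Local Notation shift := Defs.shift.
Local Notation one := (@Ordinal 2 0 isT).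
Local Notation two := (@Ordinal 2 1 isT).

(** * Words, cylinders and measures on sequence spaces *)

Section Cylinders.
Variable k : nat.
Local Notation T := (seq_space k).
Implicit Types (x y : T) (w : seq 'I_k.+1).

Lemma size_word x i n : size (word x i n) = n.
Proof. exact: size_mkseq. Qed.

Lemma wordS x i n : word x i n.+1 = x i :: word x i.+1 n.
Proof.
rewrite /word /mkseq /= addn0 (iotaDl 1 0) -map_comp; congr (_ :: _).
by apply: eq_map => j /=; rewrite add1n addnS addSn.
Qed.

Lemma word_shift x i n : word (shift x) i n = word x i.+1 n.
Proof. by apply: eq_map => j; rewrite /shift addSn. Qed.

Lemma word_iter_shift x m i n :
  word (iter m (@shift k) x) i n = word x (m + i)%N n.
Proof.
by elim: m i => // m IH i; rewrite iterS word_shift IH addnS addSn.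
Qed.

Lemma word_cat x i m n : word x i (m + n) = word x i m ++ word x (i + m)%N n.
Proof.
rewrite /word /mkseq iotaD map_cat add0n; congr (_ ++ _).
by rewrite -[m in iota m]addn0 iotaDl -map_comp; apply: eq_map => j /=; rewrite addnA.
Qed.

Lemma word_rcons x i n : word x i n.+1 = rcons (word x i n) (x (i + n)%N).
Proof. by rewrite -[in LHS]addn1 word_cat wordS /= cats1. Qed.

Lemma word_eqP x y i n :
  (forall j, (j < n)%N -> x (i + j)%N = y (i + j)%N) -> word x i n = word y i n.
Proof. by move=> xy; apply/eq_in_map => j; rewrite mem_iota => /xy. Qed.

Lemma word_inj x y i n j :
  word x i n = word y i n -> (j < n)%N -> x (i + j)%N = y (i + j)%N.
Proof.
move=> E jn; have := congr1 (fun s => nth (x 0%N) s j) E.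
by rewrite !nth_mkseq.
Qed.

Lemma open_coord (i : nat) (a : 'I_k.+1) : open [set x : T | x i = a].
Proof.
have /continuousP/(_ [set a]) := @Defs.coord_continuous k i; apply.
exact: discrete_open.
Qed.

Lemma open_cylinder w : open (cylinder [set: T] w).
Proof.
have E : forall i, open [set x : T | word x i (size w) = w].
  elim: w => [|a w IH] i.
    rewrite [X in open X](_ : _ = setT); first exact: openT.
    by apply/seteqP; split.
  rewrite [X in open X](_ : _ = [set x : T | x i = a] `&`
     [set x : T | word x i.+1 (size w) = w]).
    exact: openI (open_coord i a) (IH i.+1).
  by apply/seteqP; split => x; rewrite /= wordS; case=> -> ->.
have := E 0%N; congr open.
by apply/seteqP; split => x //= [].
Qed.

Lemma cylinder_word x n : cylinder [set: T] (word x 0 n) x.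
Proof. by split => //; rewrite size_word. Qed.

Lemma nbhs_cylinder x n : nbhs x (cylinder [set: T] (word x 0 n)).
Proof.
by apply: open_nbhs_nbhs; split; [exact: open_cylinder|exact: cylinder_word].
Qed.

(** If no cylinder around [x] fitted into the neighbourhood, a choice of bad
    points would give a sequence converging to [x] coordinatewise. *)
Lemma nbhs_cylinder_sub x (U : set T) :
  nbhs x U -> exists n, cylinder [set: T] (word x 0 n) `<=` U.
Proof.
move=> xU; apply: contrapT => /forallNP noc.
have /choice[u uP] : forall n, exists y, cylinder [set: T] (word x 0 n) y /\ ~ U y.
  by move=> n; have /existsNP[y /not_implyP[]] := noc n; exists y.
have : u @ \oo --> x.
  apply/cvg_sup => i V [_ [[W oW <-] Wx] WV].
  apply: filterS WV _; exists i.+1 => // n /= ni.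
  have [[_ +] _] := uP n; rewrite size_word => /word_inj/(_ ni) /=.
  by rewrite add0n => ->.
move=> /(_ U xU) [N _ /(_ N (leqnn N))].
by have [] := uP N.
Qed.

Lemma cylinder_within_continuous (X : set T) (M : topologicalType) (f : T -> M) :
  (forall x, X x -> exists n, forall y, X y -> word y 0 n = word x 0 n ->
     f y = f x) ->
  {within X, continuous f}.
Proof.
move=> H; apply/subspace_continuousP => x Xx.
have [n fn] := H _ Xx.
apply: cvg_near_cst; apply: filterS (nbhs_cylinder x n) => y [_].
by rewrite size_word => yx Xy; apply: fn.
Qed.

Lemma measurable_cylinder w : measurable (cylinder [set: T] w).
Proof. by apply: sub_sigma_algebra; exact: open_cylinder. Qed.

Lemma measurable_coord i a : measurable [set x : T | x i = a].
Proof. by apply: sub_sigma_algebra; exact: open_coord. Qed.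

Lemma measurable_word i w : measurable [set x : T | word x i (size w) = w].
Proof.
elim: w i => [|a w IH] i.
  rewrite [X in measurable X](_ : _ = setT) //.
  by apply/seteqP; split.
rewrite [X in measurable X](_ : _ = [set x : T | x i = a] `&`
   [set x : T | word x i.+1 (size w) = w]).
  by apply: measurableI; [exact: measurable_coord|exact: IH].
by apply/seteqP; split => x; rewrite /= wordS; case=> -> ->.
Qed.

Lemma measurable_sft (A : 'M[bool]_k.+1) : measurable (sft A).
Proof.
rewrite [X in measurable X](_ : _ = \bigcap_n
   \big[setU/set0]_(p : 'I_k.+1 * 'I_k.+1 | A p.1 p.2)
     ([set x : T | x n = p.1] `&` [set x : T | x n.+1 = p.2])).
  apply: bigcapT_measurable => n; apply: bigsetU_measurable => p _.
  by apply: measurableI; exact: measurable_coord.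
apply/seteqP; split => x.
  move=> Ax n _ /=; rewrite -bigcup_seq_cond.
  by exists (x n, x n.+1) => //=; rewrite mem_index_enum Ax.
move=> Ax n; have := Ax n Logic.I; rewrite -bigcup_seq_cond.
by case=> p /= /andP[_ Ap] [-> ->].
Qed.

Lemma measurable_shift : measurable_fun [set: T] (@shift k).
Proof.
apply: (@measurability _ _ _ _ _ _ (@open T)) => //.
move=> _ [U oU <-]; rewrite setTI; apply: sub_sigma_algebra.
move: oU; apply: (continuousP _).1; apply: seq_space_continuous => i.
exact: Defs.coord_continuous.
Qed.

Lemma sft_shift (A : 'M[bool]_k.+1) m x : sft A x -> sft A (iter m (@shift k) x).
Proof. by move=> Ax; elim: m => // m IH n /=; apply: IH. Qed.

Section Measures.
Variable R : realType.

(** As there are countably many words, every open set is a countable union of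
    cylinders; the cylinders thus form a pi-system generating the Borel sets. *)
Lemma measure_eq_cylinder (mu nu : probability T R) :
  (forall w, mu (cylinder [set: T] w) = nu (cylinder [set: T] w)) ->
  forall B, measurable B -> mu B = nu B.
Proof.
move=> E; pose G := set0 |` range (fun w => cylinder [set: T] w).
have GE : @measurable _ T = <<s G >>.
  apply/seteqP; split.
    apply: smallest_sub; first exact: smallest_sigma_algebra.
    move=> U oU.
    rewrite (_ : U = \bigcup_(w in [set w | cylinder [set: T] w `<=` U])
                       cylinder [set: T] w); last first.
      apply/seteqP; split => [x Ux|x [w /=]]; last by apply.
      have [n nU] := nbhs_cylinder_sub (open_nbhs_nbhs (conj oU Ux)).
      by exists (word x 0 n) => //; exact: cylinder_word.
    rewrite bigcup_mkcond.
    apply: (@countable_bigcupT_measurable _ (g_sigma_algebraType G)).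
      exact: countableP.
    move=> w; case: ifP => _; last exact: measurable0.
    by apply: sub_sigma_algebra; right; exists w.
  apply: smallest_sub; first exact: sigma_algebra_measurable.
  by move=> _ [->|[w _ <-]]; [exact: measurable0|exact: measurable_cylinder].
apply: (measure_unique G (fun=> setT)) => //.
- move=> A B [->|[u _ <-]]; first by rewrite set0I; left.
  case=> [->|[v _ <-]]; first by rewrite setI0; left.
  wlog uv : u v / (size u <= size v)%N.
    by move=> H; case: (leqP (size u) (size v)) => [|/ltnW] /H//; rewrite setIC.
  have [vu|vu] := eqVneq (take (size u) v) u; [right|left].
    exists v => //; apply/seteqP; split => x /=; last by case.
    move=> [_ xv]; split => //; split => //.
    by rewrite -[in RHS]vu -xv; rewrite -(subnKC uv) word_cat take_size_cat ?size_word.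
  apply/seteqP; split => x //= [[_ xu] [_ xv]]; move/eqP: vu; apply.
  by rewrite -xv -(subnKC uv) word_cat take_size_cat ?size_word.
- by move=> _; right; exists [::] => //; apply/seteqP; split.
- by apply/seteqP; split => // x _; exists 0%N.
- by move=> A [->|[w _ <-]]; [rewrite !measure0|exact: E].
- by move=> _; rewrite [X in (X < _)%E](@probability_setT _ _ _ mu) ltry.
Qed.
End Measures.
End Cylinders.

(** * Sums over words and words under an invariant measure *)

Section TupleSums.
Variables (V : nmodType) (A : finType).
Implicit Types (F : seq A -> V) (P : pred (seq A)).

Lemma sum_tuple_cons n P F :
  \sum_(u : n.+1.-tuple A | P u) F u =
  \sum_a \sum_(u : n.-tuple A | P (a :: u)) F (a :: u).
Proof.
rewrite pair_big_dep /=.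
rewrite (reindex (fun au : A * n.-tuple A => cons_tuple au.1 au.2)) //=.
exists (fun u : n.+1.-tuple A => (thead u, behead_tuple u)).
  by case=> a u _ /=; rewrite theadE; congr (_, _); exact: val_inj.
by move=> u _ /=; rewrite [RHS]tuple_eta; exact: val_inj.
Qed.

Lemma sum_tuple_nil P F :
  \sum_(u : 0.-tuple A | P u) F u = if P [::] then F [::] else 0.
Proof.
rewrite big_mkcond (eq_bigr (fun=> if P [::] then F [::] else 0)); last first.
  by move=> u _; rewrite tuple0.
by rewrite sumr_const card_tuple expn0 mulr1n.
Qed.

Lemma sum_tuple_rcons n F :
  \sum_(u : n.+1.-tuple A) F u =
  \sum_(u : n.-tuple A) \sum_a F (rcons u a).
Proof.
elim: n F => [|n IH] F.
  rewrite (sum_tuple_cons _ predT) (sum_tuple_nil predT (fun u => \sum_a F (rcons u a))).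
  by apply: eq_bigr => a _; rewrite (sum_tuple_nil predT (fun u => F (a :: u))).
rewrite (sum_tuple_cons _ predT) (sum_tuple_cons _ predT (fun u => \sum_a F (rcons u a))).
by apply: eq_bigr => a _; rewrite (IH (fun u => F (a :: u))).
Qed.

End TupleSums.

Lemma ler_sum_tuple_cat (R : numDomainType) (A : finType) (F : seq A -> R)
    (w : seq A) n : (forall v, size v = (size w + n)%N -> 0 <= F v) ->
  \sum_(v : n.-tuple A) F (w ++ v) <= \sum_(v : (size w + n).-tuple A) F v.
Proof.
elim: w F => [|a w IH] F F0 //=.
rewrite (sum_tuple_cons _ predT) (bigD1 a) //=.
apply: ler_wpDr.
  by apply: sumr_ge0 => b _; apply: sumr_ge0 => v _; rewrite F0 //= size_tuple.
by apply: (IH (fun v => F (a :: v))) => v vn; rewrite F0 //= vn.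
Qed.

(** The properties of the function taking a word to the measure of its cylinder
    that express the invariance of a probability measure. *)
Definition invariant_words (R : numDomainType) (A : finType) (m : seq A -> R) :=
  [/\ m [::] = 1, forall w, 0 <= m w,
      forall w, \sum_a m (a :: w) = m w &
      forall w, \sum_a m (rcons w a) = m w].

Section InvariantWords.
Variables (R : numDomainType) (A : finType) (m : seq A -> R).
Hypothesis im : invariant_words m.

Let m1 : m [::] = 1. Proof. by case: im. Qed.
Let m0 w : 0 <= m w. Proof. by case: im. Qed.
Let ml w : \sum_a m (a :: w) = m w. Proof. by case: im. Qed.
Let mr w : \sum_a m (rcons w a) = m w. Proof. by case: im. Qed.

Lemma inv_sum_catr n w : \sum_(v : n.-tuple A) m (w ++ v) = m w.
Proof.
elim: n w => [|n IH] w.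
  by rewrite (sum_tuple_nil predT (fun v => m (w ++ v))) cats0.
rewrite (sum_tuple_cons _ predT (fun v => m (w ++ v))) -[RHS]mr.
by apply: eq_bigr => a _; rewrite -IH; apply: eq_bigr => v _; rewrite cat_rcons.
Qed.

Lemma inv_sum_catl n w : \sum_(v : n.-tuple A) m (v ++ w) = m w.
Proof.
elim: n => [|n IH]; first by rewrite (sum_tuple_nil predT (fun v => m (v ++ w))).
rewrite (sum_tuple_cons _ predT (fun v => m (v ++ w))) exchange_big -[RHS]IH.
by apply: eq_bigr => v _; rewrite -[RHS]ml.
Qed.

Lemma inv_sum n : \sum_(v : n.-tuple A) m v = 1.
Proof. by rewrite -m1 -(inv_sum_catr n). Qed.

Lemma inv_le_catr w v : m (w ++ v) <= m w.
Proof.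
rewrite -[leRHS](inv_sum_catr (size v)) (bigD1 (in_tuple v)) //=.
by rewrite lerDl; apply: sumr_ge0.
Qed.

Lemma inv_le_catl w v : m (w ++ v) <= m v.
Proof.
rewrite -[leRHS](inv_sum_catl (size w)) (bigD1 (in_tuple w)) //=.
by rewrite lerDl; apply: sumr_ge0.
Qed.

End InvariantWords.

Section WordMeasure.
Variables (R : realType) (k : nat).
Local Notation T := (seq_space k).
Implicit Types (mu : probability T R) (w : seq 'I_k.+1).

(** The finitely many fibres of [h] cut [B] into measurable pieces; with [h] a
    coordinate or an initial word this yields all additivity relations below. *)
Lemma measure_partition d (S : measurableType d) (nu : probability S R)
    (I : finType) (h : S -> I) (B : set S) :
  (forall i, measurable (h @^-1` [set i])) -> measurable B ->
  fine (nu B) = \sum_i fine (nu (B `&` h @^-1` [set i])).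
Proof.
move=> mh mB; rewrite sum_fine; last first.
  by move=> i _; apply: fin_num_measure; exact: measurableI.
congr fine; transitivity (nu (\bigcup_i (B `&` h @^-1` [set i]))).
  by congr (nu _); apply/seteqP; split => [x Bx|x [i _ []//]]; exists (h x).
rewrite measure_fin_bigcup //.
- rewrite [RHS]bigfs ?index_enum_uniq //; last by move=> i _; rewrite mem_index_enum.
  by apply: eq_fsbigl; apply/seteqP; split.
- exact: finite_finset.
- by move=> i j _ _ [x [[_ <-] [_ <-]]].
- by move=> i _; exact: measurableI.
Qed.

Definition wmeas mu w : R := fine (mu (cylinder [set: T] w)).

Lemma wmeas_ge0 mu w : 0 <= wmeas mu w.
Proof. by rewrite fine_ge0. Qed.

Lemma wmeasE mu w : mu (cylinder [set: T] w) = (wmeas mu w)%:E.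
Proof. by rewrite fineK // fin_num_measure //; exact: measurable_cylinder. Qed.

Lemma wmeas_carried mu (X : set T) w : measurable X -> mu X = 1%E ->
  fine (mu (cylinder X w)) = wmeas mu w.
Proof.
move=> mX X1; congr fine; apply/esym.
rewrite [X in mu X = _](_ : _ = (cylinder setT w `&` X) `|`
    (cylinder setT w `&` ~` X)); last by rewrite -setIUr setUv setIT.
rewrite measureU.
- rewrite [X in (_ + X)%E](_ : _ = 0%E) ?adde0.
    congr (mu _); apply/seteqP; split => [x [[_ xw] Xx]|x [Xx xw]].
      by split.
    by split; first split.
  apply: (@subset_measure0 _ _ _ mu _ (~` X)) => //.
  - by apply: measurableI; [exact: measurable_cylinder|exact: measurableC].
  - exact: measurableC.
  - by apply: etrans (probability_setC mu mX) _; rewrite X1 subee.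
- by apply: measurableI => //; exact: measurable_cylinder.
- by apply: measurableI; [exact: measurable_cylinder|exact: measurableC].
- by apply/seteqP; split => // x [[_ Xx] [_ /(_ Xx)]].
Qed.

Lemma wmeas_invariant mu (X : set T) : shift_invariant X mu ->
  invariant_words (wmeas mu).
Proof.
move=> [_ inv]; split.
- rewrite /wmeas (_ : cylinder _ _ = setT) ?probability_setT //.
  by apply/seteqP; split.
- exact: wmeas_ge0.
- move=> w; rewrite {2}/wmeas -inv; last exact: measurable_cylinder.
  rewrite (@measure_partition _ _ _ _ (fun x : T => x 0%N : 'I_k.+1)).
  + apply: eq_bigr => a _; congr (fine (mu _)).
    apply/seteqP; split => x; rewrite /cylinder /= wordS word_shift.
      by case=> _ [-> ->].
    by case=> [[_ ->] ->].
  + by move=> a; exact: (measurable_coord 0 a).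
  + by rewrite -[X in measurable X]setTI; apply: measurable_shift => //;
      exact: measurable_cylinder.
- move=> w.
  rewrite [RHS](@measure_partition _ _ _ _ (fun x : T => x (size w) : 'I_k.+1)).
  + apply: eq_bigr => a _; congr (fine (mu _)).
    apply/seteqP; split => x; rewrite /cylinder /= size_rcons word_rcons.
      by case=> _ /rcons_inj[-> ->].
    by case=> [[_ ->] ->].
  + by move=> a; exact: (measurable_coord _ a).
  + exact: measurable_cylinder.
Qed.

End WordMeasure.

Section Fibre.
Variables (R : realType) (k l : nat) (p : 'I_k.+1 -> 'I_l.+1).
Implicit Types (F : seq 'I_k.+1 -> R) (w : seq 'I_l.+1).

Definition fibre_sum w F : R :=
  \sum_(u : (size w).-tuple 'I_k.+1 | map p u == w) F u.

Lemma fibre_sum_nil F : fibre_sum [::] F = F [::].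
Proof. by rewrite /fibre_sum (sum_tuple_nil (fun u => map p u == [::])). Qed.

Lemma fibre_sum_cons b w F :
  fibre_sum (b :: w) F =
  \sum_(a | p a == b) fibre_sum w (fun u => F (a :: u)).
Proof.
rewrite /fibre_sum (sum_tuple_cons _ (fun u => map p u == b :: w)) [RHS]big_mkcond.
apply: eq_bigr => a _.
under eq_bigl do rewrite map_cons eqseq_cons.
by case: (p a == b) => //; rewrite big_pred0.
Qed.

Lemma eq_fibre_sum w F G :
  (forall u, size u = size w -> map p u = w -> F u = G u) ->
  fibre_sum w F = fibre_sum w G.
Proof. by move=> FG; apply: eq_bigr => u /eqP pu; rewrite FG ?size_tuple. Qed.

Lemma fibre_sum_cat w w' F :
  fibre_sum (w ++ w') F = fibre_sum w (fun u => fibre_sum w' (fun v => F (u ++ v))).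
Proof.
elim: w F => [|b w IH] F /=; first by rewrite fibre_sum_nil.
by rewrite !fibre_sum_cons; apply: eq_bigr => a _; rewrite IH.
Qed.

Lemma fibre_sumZr w F c : fibre_sum w (fun u => F u * c) = fibre_sum w F * c.
Proof. by rewrite /fibre_sum mulr_suml. Qed.

Lemma fibre_sumZl w F c : fibre_sum w (fun u => c * F u) = c * fibre_sum w F.
Proof. by rewrite /fibre_sum mulr_sumr. Qed.

Lemma wmeas_distribution (mu : probability (seq_space k) R) w :
  wmeas (distribution mu (one_block p)) w = fibre_sum w (wmeas mu).
Proof.
have sz x : size (word x 0 (size w)) == size w by rewrite size_word.
rewrite /wmeas /distribution /pushforward.
rewrite (@measure_partition _ _ _ _ _
  (fun x : seq_space k => Tuple (sz k x))); first last.
- by rewrite -[X in measurable X]setTI; apply: one_block_measurable => //;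
    exact: measurable_cylinder.
- move=> u; have := @measurable_word k 0 u; rewrite size_tuple; congr measurable.
  apply/seteqP; split => x /=; first by move=> xu; exact: val_inj.
  by move=> /(congr1 val).
have pw x : word (one_block p x) 0 (size w) = map p (word x 0 (size w)).
  by rewrite /word /mkseq -map_comp.
rewrite /fibre_sum [RHS]big_mkcond; apply: eq_bigr => u _.
case: eqP => [uw|uw].
  congr (fine (mu _)); apply/seteqP; split => x; rewrite /cylinder /= size_tuple.
    by case=> _ /(congr1 val) /=.
  case=> _ xu; rewrite pw; have -> : map p (word x 0 (size w)) = w by rewrite xu.
  by split => //; exact: val_inj.
rewrite [X in mu X](_ : _ = set0) ?measure0 //.
apply/seteqP; split => x //; rewrite /cylinder /= => -[[_ xw]] /(congr1 val) /= xu.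
by apply: uw; rewrite -xu -pw.
Qed.
End Fibre.

(** * Rigidity of laws with zero relative entropy rate *)

Section Sublinear.
Variable R : realType.
Implicit Types (c : nat -> R) (K : R).

Lemma sublinear_near c K : (fun n => c n / n%:R) @ \oo --> (0 : R) -> 0 < K ->
  \forall n \near \oo, c n <= K * n%:R.
Proof.
move=> /cvgrPdist_le c0 K0; have {c0} := c0 _ K0 => c0; near=> n.
have nR : 0 < n%:R :> R by rewrite ltr0n; near: n; exact: nbhs_infty_gt.
rewrite -ler_pdivrMr //; apply: le_trans (ler_norm _) _.
by rewrite -normrN -sub0r; near: n.
Unshelve. all: by end_near. Qed.

(** The form in which the sublinear error terms enter: a positive slope would
    eventually win. *)
Lemma sublinear_slope_le0 c K b N :
  (fun n => c n / n%:R) @ \oo --> (0 : R) ->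
  (forall n, K * n%:R + b <= c (N + n)%N) -> K <= 0.
Proof.
move=> c0 H; rewrite leNgt; apply/negP => K0.
have K2 : 0 < K / 2 by rewrite divr_gt0.
have [M _ cM] := sublinear_near c0 K2.
have [L KL] : exists L : nat, (K / 2 * N%:R - b) / (K / 2) < L%:R.
  exists (Num.bound `|(K / 2 * N%:R - b) / (K / 2)|).
  exact: le_lt_trans (ler_norm _) (archi_boundP (normr_ge0 _)).
have := H (M + L)%N; have := cM (N + (M + L))%N => /=.
rewrite addnCA leq_addr => /(_ isT) h1 /le_trans/(_ h1).
move: KL; rewrite ltr_pdivrMr // !natrD => KL.
have M0 : 0 <= M%:R :> R by rewrite ler0n.
apply/negP; rewrite -ltNge addrC.
move: KL K2 M0; move: (M%:R) (L%:R) (N%:R) => m l n; nra.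
Qed.

End Sublinear.

Section Rigidity.
Variables (R : realType) (A : finType) (m r : seq A -> R) (c : nat -> R).
Hypothesis im : invariant_words m.
Hypothesis r_ge0 : forall w, 0 <= r w.
Hypothesis r_left : forall w, w != [::] -> \sum_a r (a :: w) = r w.
Hypothesis m_le_r : forall w, w != [::] -> m w <= expR (c (size w)) * r w.
Hypothesis c_sub : (fun n => c n / n%:R) @ \oo --> (0 : R).

Let m0 w : 0 <= m w. Proof. by case: im. Qed.
Let ml w : \sum_a m (a :: w) = m w. Proof. by case: im. Qed.

Let m_eq0 w : w != [::] -> r w = 0 -> m w = 0.
Proof.
move=> w0 rw; apply/eqP; rewrite eq_le m0 andbT.
by rewrite (le_trans (m_le_r w0)) // rw mulr0.
Qed.

Let r_gt0 w : w != [::] -> 0 < m w -> 0 < r w.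
Proof.
move=> w0 mw; rewrite lt_def r_ge0 andbT; apply/eqP => rw.
by rewrite (m_eq0 w0 rw) ltxx in mw.
Qed.

Let gain a v := m (a :: v) * (ln (m (a :: v) / r (a :: v)) - ln (m v / r v)).
Let pred_mass a v := r (a :: v) / r v * m v.

(** [gain a v] is a term of the mean relative entropy of the law of the letter
    preceding [v] under [m] with respect to its law under [r].  The bound is the
    tangent inequality [ln z <= z - 1]; the free parameter [t] replaces the
    equality case, since an inequality valid for all [t] determines both sides. *)
Let gain_ge a v t : v != [::] -> 0 < t ->
  m (a :: v) * ln t + m (a :: v) - t * pred_mass a v <= gain a v.
Proof.
move=> v0 t0; rewrite /gain /pred_mass.
have s0 : 0 <= r (a :: v) / r v * m v by rewrite mulr_ge0 // divr_ge0.
have [mav|mav] := eqVneq (m (a :: v)) 0.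
  by rewrite mav !mul0r !add0r oppr_le0 mulr_ge0 // ltW.
have {}mav : 0 < m (a :: v) by rewrite lt_def mav m0.
have mv : 0 < m v by apply: lt_le_trans mav _; exact: (inv_le_catl im [:: a] v).
have rav : 0 < r (a :: v) by exact: r_gt0.
have rv : 0 < r v by exact: r_gt0.
set X := ln _ - ln _.
set z := t * (r (a :: v) / r v * m v) / m (a :: v).
have z0 : 0 < z by rewrite !(divr_gt0, mulr_gt0).
have lz : ln z = ln t - X.
  rewrite /z /X !lnM ?posrE ?(invr_gt0, mulr_gt0) // !lnV ?posrE //.
  lra.
have := le_ln1Dx (_ : -1 < z - 1).
have -> : 1 + (z - 1) = z by ring.
move=> /(_ _); rewrite lz => h.
have {}h : ln t - X <= z - 1 by apply: h; lra.
have mz : m (a :: v) * z = t * (r (a :: v) / r v * m v).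
  by rewrite /z mulrC divfK // gt_eqF.
rewrite -mz -subr_ge0.
have -> : m (a :: v) * X - (m (a :: v) * ln t + m (a :: v) - m (a :: v) * z) =
  m (a :: v) * (z - 1 - (ln t - X)) by ring.
by rewrite mulr_ge0 // subr_ge0.
Qed.

Let sum_pred_mass v : v != [::] -> \sum_a pred_mass a v = m v.
Proof.
move=> v0; rewrite /pred_mass -mulr_suml -mulr_suml r_left //.
have [rv|rv] := eqVneq (r v) 0; first by rewrite (m_eq0 v0 rv) mulr0.
by rewrite divff // mul1r.
Qed.

Let rel_entropy n := \sum_(v : n.-tuple A) m v * ln (m v / r v).

Let rel_entropy_step n :
  rel_entropy n.+2 - rel_entropy n.+1 =
  \sum_(v : n.+1.-tuple A) \sum_a (gain a v - m (a :: v) + pred_mass a v).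
Proof.
rewrite /rel_entropy (sum_tuple_cons _ predT (fun v => m v * ln (m v / r v))).
rewrite exchange_big -sumrB; apply: eq_bigr => v _.
have v0 : v != [::] :> seq A by case/tupleP: v.
rewrite !big_split /= sum_pred_mass // sumrN ml subrK /gain.
rewrite -{1}[m v]ml mulr_suml -sumrB.
by apply: eq_bigr => a _; rewrite mulrBr.
Qed.

Let rel_entropy_le n : rel_entropy n.+1 <= c n.+1.
Proof.
rewrite -[leRHS]mul1r -(inv_sum im n.+1) mulr_suml.
apply: ler_sum => v _.
have v0 : v != [::] :> seq A by case/tupleP: v.
have [mv|mv] := eqVneq (m v) 0; first by rewrite mv !mul0r.
have {}mv : 0 < m v by rewrite lt_def mv m0.
rewrite ler_wpM2l // -[leRHS]expRK ler_ln ?posrE ?expR_gt0 ?divr_gt0 ?r_gt0 //.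
by rewrite ler_pdivrMr ?r_gt0 //; have := m_le_r v0; rewrite size_tuple.
Qed.

(** The relative entropy of [m] with respect to [r] on words of length [n] is at
    most [c n], hence sublinear.  Each further letter on the left increases it by
    the mean relative entropy of the conditional laws of that letter, because [m]
    is invariant and [r] is a law that is stationary to the left.  When the
    conditional probability of [a] under [r] does not change as [w] is extended
    to the right, the extensions of [w] contribute at every step at least an
    amount [T0 * ln t + (1 - t) * S] that does not depend on the step.  So this
    amount is nonpositive for all [t], which forces [T0 = S]. *)
Lemma rigidity a w : w != [::] ->
  (forall v, r (a :: w ++ v) * r w = r (a :: w) * r (w ++ v)) ->
  m (a :: w) * r w = r (a :: w) * m w.
Proof.
move=> w0 ren.
have [rw|rw] := eqVneq (r w) 0; first by rewrite rw (m_eq0 w0 rw) !mulr0.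
pose T0 := m (a :: w); pose S := pred_mass a w.
have S0 : 0 <= S by rewrite mulr_ge0 // divr_ge0.
have T00 : 0 <= T0 by exact: m0.
suff TS t : 0 < t -> T0 * ln t + (1 - t) * S <= 0.
  suff TE : T0 = S.
    by rewrite -/T0 TE /S /pred_mass mulrAC divfK.
  have lnlb (t : R) : 0 < t -> 1 - t^-1 <= ln t.
    move=> t0; have := le_ln1Dx (_ : -1 < t^-1 - 1).
    have -> : 1 + (t^-1 - 1) = t^-1 by ring.
    rewrite lnV ?posrE // => h; rewrite -lerN2.
    rewrite opprB; apply: h; rewrite ltrBrDr addNr invr_gt0 //.
  have TS' (t : R) : 0 < t -> (t - 1) * (T0 - t * S) <= 0.
    move=> t0; have := TS _ t0; have := ler_wpM2l T00 (lnlb _ t0).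
    move=> h1 h2; have h : T0 * (1 - t^-1) + (1 - t) * S <= 0 by lra.
    have := ler_wpM2l (ltW t0) h; rewrite mulr0; congr (_ <= _).
    by field; rewrite gt_eqF.
  apply/eqP; rewrite eq_le; apply/andP; split.
    rewrite leNgt; apply/negP => ST.
    have d0 : 0 < (T0 - S) / (2 * (S + 1)).
      by rewrite divr_gt0 ?subr_gt0 // mulr_gt0 // ltr_wpDl.
    have := TS' _ (addr_gt0 ltr01 d0).
    have dE : (T0 - S) / (2 * (S + 1)) * (2 * (S + 1)) = T0 - S.
      by rewrite divfK // gt_eqF // mulr_gt0 // ltr_wpDl.
    move: d0 dE; set d := _ / _ => d0 dE; nra.
  rewrite leNgt; apply/negP => ST.
  have S1 : 0 < S by exact: le_lt_trans ST.
  have dE : (T0 + S) / (2 * S) * (2 * S) = T0 + S.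
    by rewrite divfK // gt_eqF // mulr_gt0.
  have d0 : 0 < (T0 + S) / (2 * S) by apply: divr_gt0; [lra|rewrite mulr_gt0].
  have := TS' _ d0; move: d0 dE; set d := _ / _ => d0 dE; nra.
move=> t0; have [n nw] : exists n, size w = n.+1 by case: (w) w0 => // b s; exists (size s).
have inc j : T0 * ln t + (1 - t) * S <=
    rel_entropy (size w + j).+1 - rel_entropy (size w + j).
  rewrite nw addSn rel_entropy_step -addSn -nw.
  pose F v := \sum_b (gain b v - m (b :: v) + pred_mass b v).
  have F0 v b : v != [::] -> 0 <= gain b v - m (b :: v) + pred_mass b v.
    by move=> v0; have := gain_ge b v0 ltr01; rewrite ln1 mulr0 mul1r; lra.
  apply: le_trans (ler_sum_tuple_cat (F := F) _); last first.
    by move=> v vs; apply: sumr_ge0 => b _; apply: F0; rewrite -size_eq0 vs nw.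
  have -> : T0 * ln t + (1 - t) * S =
      \sum_(v : j.-tuple A)
        (m (a :: w ++ v) * ln t + (1 - t) * (r (a :: w) / r w * m (w ++ v))).
    rewrite big_split /= -mulr_suml -mulr_sumr -mulr_sumr.
    by rewrite (inv_sum_catr im) (inv_sum_catr im j (a :: w)).
  apply: ler_sum => v _.
  have wv0 : w ++ v != [::] by rewrite -size_eq0 size_cat nw.
  have -> : r (a :: w) / r w * m (w ++ v) = pred_mass a (w ++ v).
    rewrite /pred_mass.
    have [rwv|rwv] := eqVneq (r (w ++ v)) 0; first by rewrite (m_eq0 wv0 rwv) !mulr0.
    by congr (_ * _); apply/eqP; rewrite eqr_div // ren.
  apply: (@le_trans _ _ (gain a (w ++ v) - m (a :: w ++ v) + pred_mass a (w ++ v))).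
    by have := gain_ge a wv0 t0; lra.
  rewrite /F (bigD1 a) //= lerDl; apply: sumr_ge0 => b _; exact: F0.
apply: (@sublinear_slope_le0 _ c _ (rel_entropy (size w)) (size w)) => // j.
apply: (@le_trans _ _ (rel_entropy (size w + j))); last first.
  by rewrite nw addSn; exact: rel_entropy_le.
elim: j => [|j IH]; first by rewrite mulr0 add0r addn0.
have := inc j; rewrite addnS -natr1; lra.
Qed.

End Rigidity.

Section InvariantVector.
Variables (R : realType) (I : finType) (W : I -> I -> R) (d : I -> R) (c : R).
Variable V : nat -> I -> R.
Hypothesis W_ge0 : forall i j, 0 <= W i j.
Hypothesis c_gt0 : 0 < c.
Hypothesis V_step : forall n j, V n.+1 j = \sum_i V n i * W i j.
Hypothesis V_bounds : forall n j, c^-1 * d j <= V n j <= c * d j.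

Let apply_W (x : I -> R) j := \sum_i x i * W i j.

Let apply_W_le x y : (forall i, x i <= y i) -> forall j, apply_W x j <= apply_W y j.
Proof. by move=> xy j; apply: ler_sum => i _; exact: ler_wpM2r. Qed.

Let apply_W_cvg (u : nat -> I -> R) (x : I -> R) :
  (forall i, u n i @[n --> \oo] --> x i) ->
  forall j, apply_W (u n) j @[n --> \oo] --> apply_W x j.
Proof.
move=> ux j; apply: cvg_big => [|i _]; first exact: add_continuous.
by apply: cvgM; [exact: ux|exact: cvg_cst].
Qed.

(** A substitute for the Perron-Frobenius theorem, for a matrix with an orbit
    that is bounded above and below.  By Fatou's inequality the lower limit [x] of
    the orbit satisfies [x W <= x]; its iterates therefore decrease to an
    invariant vector, which is positive where [d] is because they stay above a
    multiple of the orbit. *)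
Lemma invariant_vector :
  exists l : I -> R, (forall j, c^-1 ^+ 3 * d j <= l j) /\
    forall j, \sum_i l i * W i j = l j.
Proof.
pose y N j := inf [set V (N + i)%N j | i in [set: nat]].
have lbV N j : has_lbound [set V (N + i)%N j | i in [set: nat]].
  exists (c^-1 * d j) => _ [i _ <-]; by have /andP[] := V_bounds (N + i) j.
have y_le N i j : y N j <= V (N + i)%N j by apply: ge_inf => //; exists i.
have y_ge N j t : (forall i, t <= V (N + i)%N j) -> t <= y N j.
  by move=> tV; apply: lb_le_inf; [exists (V (N + 0)%N j), 0%N|move=> _ [i _ <-]].
have y_lb N j : c^-1 * d j <= y N j.
  by apply: y_ge => i; have /andP[] := V_bounds (N + i) j.
have y_nd j : {homo y^~ j : n m / (n <= m)%N >-> n <= m}.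
  move=> n m nm; apply: y_ge => i; rewrite -(subnKC nm) -addnA; exact: y_le.
have y_cvg j : cvgn (y^~ j).
  apply: nondecreasing_is_cvgn => //; exists (c * d j) => _ [n _ <-].
  by apply: le_trans (y_le n 0%N j) _; have /andP[] := V_bounds (n + 0) j.
pose x j : R := limn (y^~ j).
have x_lb j : c^-1 * d j <= x j.
  by apply: le_trans (y_lb 0%N j) _; exact: nondecreasing_cvgn_le.
have Wy N j : apply_W (y N) j <= y N.+1 j.
  apply: y_ge => i; rewrite addSn V_step; apply: ler_sum => h _.
  by apply: ler_wpM2r => //; exact: y_le.
have yx j : y n j @[n --> \oo] --> x j by exact: y_cvg.
have yS j : y n.+1 j @[n --> \oo] --> x j.
  by have := yx j; rewrite -(cvg_shiftS (y^~ j)).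
have Wx j : apply_W x j <= x j.
  by apply: (ler_cvg_to (@apply_W_cvg _ _ yx j) (@yS j)); apply: nearW => N; exact: Wy.
pose z n := iter n apply_W x.
have z_lb n j : c^-1 ^+ 2 * V n.+1 j <= z n j.
  elim: n j => [|n IH] j.
    apply: le_trans (x_lb j); have /andP[_ h] := V_bounds 1 j.
    rewrite expr2 -mulrA; apply: ler_wpM2l; first by rewrite invr_ge0 ltW.
    by rewrite ler_pdivrMl.
  rewrite V_step mulr_sumr; apply: ler_sum => i _.
  by rewrite mulrA ler_wpM2r.
have z_lb' n j : c^-1 ^+ 3 * d j <= z n j.
  apply: le_trans (z_lb n j); rewrite exprSr -mulrA ler_wpM2l //.
    by rewrite exprn_ge0 // invr_ge0 ltW.
  by have /andP[] := V_bounds n.+1 j.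
have z_step n j : z n.+1 j <= z n j.
  by elim: n j => [|n IH] j; [exact: Wx|exact: apply_W_le].
have z_ni j : {homo z^~ j : n m / (n <= m)%N >-> m <= n}.
  by apply/nonincreasing_seqP => n; exact: z_step.
have z_cvg j : cvgn (z^~ j).
  by apply: nonincreasing_is_cvgn => //; exists (c^-1 ^+ 3 * d j) => _ [n _ <-].
have zl j : z n j @[n --> \oo] --> limn (z^~ j) by exact: z_cvg.
exists (fun j => limn (z^~ j)); split => j.
  by apply: limr_ge => //; apply: nearW => n.
have zS : z n.+1 j @[n --> \oo] --> limn (z^~ j).
  by have := zl j; rewrite -(cvg_shiftS (z^~ j)).
exact: cvg_unique (@apply_W_cvg _ _ zl j) zS.
Qed.

End InvariantVector.

(** * Invariant Gibbs measures of functions of two coordinates are Markov *)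

Lemma cvg_cst_over_n (R : realType) (a : R) :
  (fun n => a / n%:R) @ \oo --> (0 : R).
Proof.
rewrite -(cvg_shiftS (fun n => a / n%:R)).
have := cvgM (@cvg_cst R a _ \oo _) (@cvg_harmonic R).
by rewrite mulr0; apply.
Qed.

Section GibbsMarkov.
Variables (R : realType) (k : nat) (A : 'M[bool]_k.+1).
Variables (f : seq_space k -> R) (mu : probability (seq_space k) R) (P C : R).
Local Notation T := (seq_space k).
Local Notation X := (sft A).
Local Notation m := (wmeas mu).
Hypothesis f2 : two_coordinates X f.
Hypothesis inv : shift_invariant X mu.
Hypothesis C_gt0 : 0 < C.
Hypothesis gb : gibbs_bounds X f mu P (fun=> C).

Let im : invariant_words m := wmeas_invariant inv.
Let m0 w : 0 <= m w. Proof. by case: im. Qed.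

Lemma gibbs_word x n : X x -> (0 < n)%N ->
  C^-1 * expR (- (n%:R * P) + birkhoff f n x) <= m (word x 0 n) <=
  C * expR (- (n%:R * P) + birkhoff f n x).
Proof.
move=> Xx n0; have := gb Xx n0.
rewrite wmeas_carried //; [|exact: measurable_sft|by case: inv].
by rewrite ler_pdivlMr ?expR_gt0 // ler_pdivrMr ?expR_gt0.
Qed.

Lemma word_gt0 x n : X x -> 0 < m (word x 0 n).
Proof.
case: n => [|n] Xx; first by case: im => ->.
have /andP[+ _] := gibbs_word Xx (ltn0Sn n); apply: lt_le_trans.
by rewrite mulr_gt0 ?invr_gt0 ?expR_gt0.
Qed.

Lemma gt0_word w : 0 < m w -> exists2 x, X x & word x 0 (size w) = w.
Proof.
move=> mw; apply: contrapT => H; move: mw.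
rewrite -(@wmeas_carried _ _ _ X); [|exact: measurable_sft|by case: inv].
rewrite (_ : cylinder X w = set0) ?measure0 ?ltxx //.
by apply/seteqP; split => // x [Xx xw]; apply: H; exists x.
Qed.

Lemma value2E x : X x -> value2 X f (x 0%N) (x 1%N) = f x.
Proof.
move=> Xx; rewrite /value2.
have [Xz zw] : cylinder X [:: x 0%N; x 1%N] (xget point (cylinder X [:: x 0%N; x 1%N])).
  by apply: xgetI; split; first exact: Xx.
by apply: f2 => //; case: zw.
Qed.

(** Transition weights normalised by the pressure [P].  Only the transitions that
    occur in [X] count: [A] may also allow transitions into symbols from which no
    infinite path starts. *)
Definition trans i j := if 0 < m [:: i; j] then expR (value2 X f i j - P) else 0.

Fixpoint path_weight (w : seq 'I_k.+1) : R :=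
  if w is a :: w' then
    if w' is b :: _ then trans a b * path_weight w' else 1
  else 1.

Lemma trans_ge0 i j : 0 <= trans i j.
Proof. by rewrite /trans; case: ifP => // _; exact: expR_ge0. Qed.

Lemma path_weight_ge0 w : 0 <= path_weight w.
Proof.
by elim: w => [|a [|b w] IH] //=; rewrite mulr_ge0 // trans_ge0.
Qed.

Lemma transE x i : X x -> trans (x i) (x i.+1) = expR (f (iter i (@shift k) x) - P).
Proof.
move=> Xx; have Xi := sft_shift i Xx.
have := value2E Xi; have := word_gt0 2 Xi.
rewrite !word_iter_shift /trans addn0 !wordS [word _ _ 0]/= => -> E.
congr (expR (_ - P)); rewrite -E.
have it j : iter i (@shift k) x j = x (i + j)%N.
  by elim: i j {E Xi} => // i IH j; rewrite iterS /shift IH addnS.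
by rewrite !it addn0 addn1.
Qed.

Lemma path_weight_word x i n : X x ->
  path_weight (word x i n.+1) = \prod_(i <= j < i + n) trans (x j) (x j.+1).
Proof.
move=> Xx; elim: n i => [|n IH] i; first by rewrite addn0 big_geq.
rewrite wordS big_ltn ?addnS ?ltnS ?leq_addr // -addSn -IH.
by rewrite [in RHS]wordS wordS.
Qed.

Lemma path_weight_birkhoff x n : X x ->
  path_weight (word x 0 n.+1) = expR (- (n%:R * P) + birkhoff f n x).
Proof.
move=> Xx; rewrite path_weight_word // add0n.
rewrite (eq_bigr (fun j => expR (f (iter j (@shift k) x) - P))); last first.
  by move=> j _; exact: transE.
rewrite -expR_sum big_split /= sumr_const_nat subn0 addrC.
by rewrite -[in LHS]mulr_natl mulrN.
Qed.

Lemma path_weight_rcons u a b :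
  path_weight (rcons (rcons u a) b) = path_weight (rcons u a) * trans a b.
Proof.
elim: u => [|c u IH] /=; first by rewrite mulr1 mul1r.
by case: u IH => [|e u] /= ->; rewrite mulrA.
Qed.

Lemma gt0_cons a b w : 0 < m [:: a; b] -> 0 < m (b :: w) -> 0 < m [:: a, b & w].
Proof.
move=> /gt0_word[x Xx xab] /gt0_word[y Xy yw].
pose z : T := fun i => if i is j.+1 then y j else a.
have Aab : A a b by have := Xx 0%N; case: xab => -> ->.
have y0 : y 0%N = b by case: yw.
have Xz : X z by case=> [|i] /=; [rewrite y0|exact: Xy].
have -> : [:: a, b & w] = word z 0 (size w).+2.
  have zS : shift z = y by [].
  by rewrite wordS -word_shift zS yw.
exact: word_gt0.
Qed.

Lemma path_weight_gt0 w : (1 < size w)%N -> 0 < path_weight w -> 0 < m w.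
Proof.
elim: w => [|a [|b w] IH] // _.
have tab : 0 < trans a b -> 0 < m [:: a; b].
  by rewrite /trans; case: ifP => //; rewrite ltxx.
case: w IH => [|c w] IH; first by rewrite /= mulr1; exact: tab.
rewrite -[path_weight _]/(trans a b * path_weight [:: b, c & w]) => h.
have [t0|t0] := ltP 0 (trans a b); last first.
  have te : trans a b = 0 by apply/le_anti; rewrite t0 trans_ge0.
  by move: h; rewrite te mul0r ltxx.
by apply: gt0_cons; [exact: tab|apply: IH => //; move: h; rewrite pmulr_rgt0].
Qed.

(** The Gibbs bounds compare a word of length [n] with [n] transitions, the last
    of which leaves the word; dropping it costs a bounded factor [S]. *)
Lemma gibbs_path_weight : exists2 D, 0 < D &
  forall w, w != [::] -> 0 < m w ->
    D^-1 * m w <= path_weight w <= D * m w.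
Proof.
pose S := 1 + \sum_i \sum_j (trans i j + (trans i j)^-1).
have t0 i j : 0 <= trans i j + (trans i j)^-1 by rewrite addr_ge0 ?invr_ge0 ?trans_ge0.
have tS i j : trans i j + (trans i j)^-1 <= S.
  rewrite /S (bigD1 i) //= (bigD1 j) //=.
  have h1 : 0 <= \sum_(i0 | i0 != j) (trans i i0 + (trans i i0)^-1) by exact: sumr_ge0.
  have h2 : 0 <= \sum_(i0 | i0 != i) \sum_j (trans i0 j + (trans i0 j)^-1).
    by apply: sumr_ge0 => h _; apply: sumr_ge0.
  lra.
have S0 : 0 < S by rewrite ltr_pwDl // sumr_ge0 // => i _; apply: sumr_ge0.
have CS : 0 < C * S by rewrite mulr_gt0.
exists (C * S) => // w w0 mw; have [x Xx xw] := gt0_word mw.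
have {w0} [n nw] : exists n, size w = n.+1 by case: (w) w0 => // b s; exists (size s).
rewrite -{}xw nw in mw *; have /andP[] := gibbs_word Xx (ltn0Sn n).
rewrite -path_weight_birkhoff // word_rcons add0n word_rcons path_weight_rcons.
rewrite add0n -word_rcons.
have tx : 0 < trans (x n) (x n.+1) by rewrite transE // expR_gt0.
have txi : 0 < (trans (x n) (x n.+1))^-1 by rewrite invr_gt0.
have h1 : trans (x n) (x n.+1) <= S.
  by apply: le_trans (tS (x n) (x n.+1)); rewrite lerDl ltW.
have h2 : (trans (x n) (x n.+1))^-1 <= S.
  by apply: le_trans (tS (x n) (x n.+1)); rewrite lerDr ltW.
have pw0 := path_weight_ge0 (word x 0 n.+1).
move: (m _) (path_weight _) (trans _ _) tx txi h1 h2 pw0 => M q t tx txi h1 h2 q0.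
rewrite ler_pdivrMl // => a1 a2; rewrite ler_pdivrMl //.
apply/andP; split.
  by apply: le_trans a2 _; rewrite -mulrA ler_wpM2l ?(ltW C_gt0) // mulrC ler_wpM2r.
have -> : q = (q * t) * t^-1 by rewrite mulfK // gt_eqF.
have q1 : 0 <= C * M by apply: le_trans a1; rewrite mulr_ge0 // ltW.
by rewrite [leRHS]mulrAC; apply: ler_pM => //; [rewrite mulr_ge0 // ltW|exact: ltW].
Qed.

(** The orbit of the constant row vector under the transition matrix adds up the
    weights of the paths of a given length that end with a symbol; by the Gibbs
    property these sums are comparable to the measure of that symbol. *)
Lemma trans_invariant_vector :
  exists l : 'I_k.+1 -> R, [/\ forall j, 0 <= l j,
    forall j, 0 < m [:: j] -> 0 < l j & forall j, \sum_i l i * trans i j = l j].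
Proof.
have [D D0 Dw] := gibbs_path_weight.
have rn (u : seq 'I_k.+1) j : rcons u j != [::] by case: u.
pose V n j := \sum_(u : n.+1.-tuple 'I_k.+1) path_weight (rcons u j).
have [||||l [ll lW]] := @invariant_vector R _ trans (fun j => m [:: j]) D V.
- exact: trans_ge0.
- exact: D0.
- move=> n j; rewrite /V (sum_tuple_rcons n.+1 (fun u => path_weight (rcons u j))).
  rewrite exchange_big; apply: eq_bigr => i _; rewrite mulr_suml.
  by apply: eq_bigr => u _; rewrite path_weight_rcons.
- move=> n j; rewrite -(inv_sum_catl im n.+1) !mulr_sumr /V.
  apply/andP; split; apply: ler_sum => u _; rewrite cats1.
    have [mu0|mu0] := ltP 0 (m (rcons u j)).
      by have /andP[] := Dw _ (rn u j) mu0.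
    apply: le_trans (path_weight_ge0 _).
    by rewrite pmulr_rle0 // invr_gt0.
  have [mu0|mu0] := ltP 0 (m (rcons u j)).
    by have /andP[] := Dw _ (rn u j) mu0.
  apply: (@le_trans _ _ 0); last by rewrite mulr_ge0 ?m0 // ltW.
  rewrite leNgt; apply/negP => /path_weight_gt0; rewrite size_rcons size_tuple.
  by move=> /(_ isT); rewrite ltNge mu0.
have D3 : 0 < D^-1 ^+ 3 by rewrite exprn_gt0 // invr_gt0.
exists l; split => // j.
  by apply: le_trans (ll j); rewrite mulr_ge0 ?m0 // ltW.
by move=> mj; apply: lt_le_trans (ll j); rewrite mulr_gt0.
Qed.

(** An invariant left vector [l] makes the law of words [l a * path_weight w]
    stationary to the left, and the Gibbs property bounds [mu] by a multiple of
    it.  By [rigidity] both have the same conditional laws, so that [mu] is a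
    Markov measure when read from right to left. *)
Lemma gibbs_markov :
  exists l : 'I_k.+1 -> R, [/\ forall j, 0 < m [:: j] -> 0 < l j,
    forall j, \sum_i l i * trans i j = l j &
    forall a b v, m [:: a, b & v] * l b = l a * trans a b * m (b :: v)].
Proof.
have [l [l0 lpos lW]] := trans_invariant_vector.
have [D D0 Dw] := gibbs_path_weight.
exists l; split => // a b v.
pose r w := if w is a :: _ then l a * path_weight w else 1.
have r0 w : 0 <= r w.
  case: w => [|c w]; first exact: ler01.
  exact: mulr_ge0 (l0 c) (path_weight_ge0 _).
have rl w : w != [::] -> \sum_c r (c :: w) = r w.
  case: w => [|e w] // _; rewrite {2}/r -lW mulr_suml.
  by apply: eq_bigr => c _ /=; rewrite mulrA.
pose S := 1 + \sum_j (l j)^-1.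
have S0 : 0 < S by rewrite ltr_pwDl // sumr_ge0 // => j _; rewrite invr_ge0.
have mr w : w != [::] -> m w <= expR (ln (D * S)) * r w.
  case: w => [|e w] // _; rewrite lnK ?posrE ?mulr_gt0 //.
  have [me|me] := ltP 0 (m (e :: w)); last first.
    by apply: le_trans me _; rewrite mulr_ge0 // mulr_ge0 // ltW.
  have le0 : 0 < l e.
    by apply: lpos; apply: lt_le_trans me _; exact: (inv_le_catr im [:: e] w).
  have lS : 1 <= S * l e.
    rewrite -ler_pdivrMr // div1r /S (bigD1 e) //=.
    have : 0 <= \sum_(j | j != e) (l j)^-1 by apply: sumr_ge0 => j _; rewrite invr_ge0.
    lra.
  have /andP[+ _] := Dw _ (isT : e :: w != [::]) me.
  rewrite ler_pdivrMl // => h; apply: le_trans h _.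
  rewrite -mulrA ler_wpM2l ?(ltW D0) // /r mulrA.
  by rewrite -[leLHS]mul1r; apply: ler_wpM2r lS; exact: path_weight_ge0.
have := @rigidity _ _ _ r (fun=> ln (D * S)) im r0 rl mr (cvg_cst_over_n _)
  a (b :: v) isT.
have ren u : r (a :: (b :: v) ++ u) * r (b :: v) = r (a :: b :: v) * r ((b :: v) ++ u).
  by rewrite /r /=; ring.
move=> /(_ ren) {ren}.
have [mbv|mbv] := ltP 0 (m (b :: v)); last first.
  move=> _; have mbv0 : m (b :: v) = 0 by apply/le_anti; rewrite mbv m0.
  have -> : m [:: a, b & v] = 0.
    by apply/le_anti; rewrite m0 andbT -mbv0; exact: (inv_le_catl im [:: a]).
  by rewrite mbv0 mul0r mulr0.
have /andP[h _] := Dw _ (isT : b :: v != [::]) mbv.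
have pw : 0 < path_weight (b :: v).
  by apply: lt_le_trans h; rewrite mulr_gt0 // invr_gt0.
move=> E; apply: (mulIf (lt0r_neq0 pw)).
transitivity (m [:: a, b & v] * r (b :: v)); first by rewrite /r mulrA.
by rewrite E /r /=; ring.
Qed.
End GibbsMarkov.

(** * Ratios of consecutive terms of a linear recurrence of order two *)

Section Recurrence.
Variables (R : realType) (e : nat -> R).
Hypothesis e_gt0 : forall j, 0 < e j.

(** Bounds [e (p + M) / e M] by multiples of [theta ^+ p] along some [M] for each
    [p]; this covers sequences with convergent ratios, for which [M] has to grow
    with [p], and sequences of period two up to a geometric factor. *)
Definition quasi_geometric (theta K : R) :=
  forall p, exists M, `|ln (e (p + M)%N / e M) - p%:R * ln theta| <= K.

Lemma ratio_cvg_quasi_geometric (theta : R) : 0 < theta ->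
  (fun j => e j.+1 / e j) @ \oo --> theta -> quasi_geometric theta 1.
Proof.
move=> t0 et.
have let_ : (fun j => ln (e j.+1 / e j)) @ \oo --> ln theta.
  by apply: (cvg_comp _ _ et); exact: continuous_ln.
have cv (p : nat) : (fun M => ln (e (p + M)%N / e M)) @ \oo --> p%:R * ln theta.
  elim: p => [|p IH].
    rewrite mul0r (_ : (fun _ => _) = fun=> 0); first exact: cvg_cst.
    by apply/funext => M; rewrite add0n divff ?ln1 // gt_eqF.
  have -> : p.+1%:R * ln theta = ln theta + p%:R * ln theta by rewrite -natr1; ring.
  rewrite (_ : (fun _ => _) =
    (fun M => ln (e (p + M).+1 / e (p + M)%N) + ln (e (p + M)%N / e M))).
    apply: cvgD => //.
    by apply: (cvg_comp (addn p) (fun j => ln (e j.+1 / e j)) _ let_); exact: cvg_addnl.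
  apply/funext => M; rewrite -lnM ?posrE ?divr_gt0 // mulrA divfK // gt_eqF //.
move=> p; have /cvgrPdist_le/(_ _ ltr01)[M _ /(_ M (leqnn M)) /= h] := cv p.
by exists M; rewrite distrC.
Qed.

Lemma period2_quasi_geometric (theta : R) : 0 < theta ->
  (forall j, e j.+2 = theta ^+ 2 * e j) ->
  quasi_geometric theta `|ln (e 1%N / e 0%N) - ln theta|.
Proof.
move=> t0 rec p; exists 0%N; rewrite addn0; set K := (X in _ <= X).
suff : `|ln (e p / e 0%N) - p%:R * ln theta| <= K /\
       `|ln (e p.+1 / e 0%N) - p.+1%:R * ln theta| <= K by case.
elim: p => [|p [h1 h2]].
  by rewrite divff ?gt_eqF // ln1 mul0r subr0 normr0 normr_ge0 mul1r.
split => //; rewrite rec -mulrA lnM ?posrE ?divr_gt0 ?exprn_gt0 // lnXn //.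
have -> : p.+2%:R = p%:R + 2 :> R by rewrite -natr1 -natr1; ring.
set L := ln (e p / _); have -> : ln theta *+ 2 + L - (p%:R + 2) * ln theta =
  L - p%:R * ln theta by ring.
exact: h1.
Qed.

(** The determinants [W] of consecutive terms are geometric with ratio [delta].  If
    [0 <= delta] they have a constant sign and the ratios are monotone; otherwise
    the roots of the characteristic polynomial have opposite signs and,
    as [0 < tau], different absolute values. *)
Lemma recurrence_ratio_cvg (tau delta lo hi : R) :
  (forall j, e j.+2 = tau * e j.+1 - delta * e j) -> 0 < tau ->
  0 < lo -> (forall j, lo <= e j.+1 / e j <= hi) ->
  exists2 theta : R, lo <= theta <= hi & (fun j => e j.+1 / e j) @ \oo --> theta.
Proof.
move=> rec tau0 lo0 xb; pose x j := e j.+1 / e j.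
suff xc : cvgn x.
  exists (limn x) => //; apply/andP; split.
    by apply: limr_ge => //; apply: nearW => j; have /andP[] := xb j.
  by apply: limr_le => //; apply: nearW => j; have /andP[] := xb j.
have x0 j : 0 < x j by rewrite divr_gt0.
have [delta0|delta0] := leP 0 delta.
  pose W j := e j.+2 * e j - e j.+1 ^+ 2.
  have Wrec j : W j.+1 = delta * W j.
    rewrite /W; have := rec j; have := rec j.+1 => -> h.
    have -> : delta * (e j.+2 * e j - e j.+1 ^+ 2) =
      e j.+2 * (delta * e j) - delta * e j.+1 ^+ 2 by ring.
    have -> : delta * e j = tau * e j.+1 - e j.+2 by rewrite h; ring.
    by ring.
  have xW j : x j.+1 - x j = W j / (e j.+1 * e j).
    by rewrite /x /W; field; rewrite !gt_eqF.
  have ee j : 0 < e j.+1 * e j by rewrite mulr_gt0.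
  have [W0|W0] := leP 0 (W 0%N).
    have Wj j : 0 <= W j by elim: j => // j IH; rewrite Wrec mulr_ge0.
    apply: nondecreasing_is_cvgn.
      by apply/nondecreasing_seqP => j; rewrite -subr_ge0 xW divr_ge0 // ltW.
    by exists hi => _ [j _ <-]; have /andP[] := xb j.
  have Wj j : W j <= 0 by elim: j => [|j IH]; [exact: ltW|rewrite Wrec mulr_ge0_le0].
  apply: nonincreasing_is_cvgn.
    apply/nonincreasing_seqP => j; rewrite -subr_le0 xW.
    by rewrite pmulr_lle0 // invr_gt0.
  by exists lo => _ [j _ <-]; have /andP[] := xb j.
pose s := Num.sqrt (tau ^+ 2 - 4 * delta).
have s2 : s ^+ 2 = tau ^+ 2 - 4 * delta.
  by rewrite sqr_sqrtr // subr_ge0 (@le_trans _ _ 0) ?exprn_ge0 ?ltW //; lra.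
have s0 : 0 <= s by exact: sqrtr_ge0.
have st : tau < s by rewrite -(@ltr_pXn2r _ 2%N) ?nnegrE ?(ltW tau0) // s2; lra.
pose al := (tau + s) / 2; pose be := (tau - s) / 2.
have al0 : 0 < al by rewrite /al; lra.
have be0 : be < 0 by rewrite /be; lra.
have abd : al * be = delta.
  have -> : al * be = (tau ^+ 2 - s ^+ 2) / 4 by rewrite /al /be; field.
  by rewrite s2; field.
have abt : al + be = tau by rewrite /al /be; field.
pose q := be / al; pose z j := (x j - al) / (x j - be).
have q1 : `|q| < 1.
  rewrite /q normrM normfV (gtr0_norm al0) (ltr0_norm be0) ltr_pdivrMr // mul1r.
  by rewrite /al /be; lra.
have xb0 j : 0 < x j - be by have := x0 j; lra.
have xrec j : x j.+1 = tau - delta / x j.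
  by rewrite /x rec; field; rewrite !gt_eqF.
have zrec j : z j.+1 = q * z j.
  have h1 : x j.+1 - al = be * (x j - al) / x j.
    by rewrite xrec -abt -abd; field; rewrite gt_eqF.
  have h2 : x j.+1 - be = al * (x j - be) / x j.
    by rewrite xrec -abt -abd; field; rewrite gt_eqF.
  rewrite /z h1 h2 /q; field.
  by rewrite (gt_eqF (x0 j)) (gt_eqF al0) (gt_eqF (xb0 j)).
have zE j : z j = q ^+ j * z 0%N.
  by elim: j => [|j IH]; [rewrite mul1r|rewrite zrec IH exprS mulrA].
have z0 : z @ \oo --> (0 : R).
  rewrite (_ : z = fun j => q ^+ j * z 0%N); last by apply/funext.
  by rewrite -[X in _ --> X](mul0r (z 0%N)); apply: cvgM; [exact: cvg_expr|exact: cvg_cst].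
have xE j : x j = (al - be * z j) / (1 - z j).
  have h : 1 - z j = (al - be) / (x j - be).
    by rewrite /z; field; rewrite gt_eqF.
  rewrite h /z; field; rewrite (gt_eqF (xb0 j)) gt_eqF // subr_gt0.
  exact: lt_trans be0 al0.
apply/cvg_ex; exists ((al - be * 0) / (1 - 0)).
rewrite (_ : x = fun j => (al - be * z j) / (1 - z j)); last by apply/funext.
apply: cvgM.
  by apply: cvgB; [exact: cvg_cst|apply: cvgM => //; exact: cvg_cst].
apply: cvgV; first by rewrite subr0 oner_neq0.
by apply: cvgB => //; exact: cvg_cst.
Qed.

End Recurrence.

(** * A potential for the factor measure *)


Lemma ord2P (a : 'I_2) : a = one \/ a = two.
Proof. by case: a => [[|[|a]] h] //; [left|right]; exact: val_inj. Qed.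

Lemma neq_one (a : 'I_2) : a != one -> a = two.
Proof. by case: (ord2P a) => ->. Qed.

Lemma birkhoffD (R : realType) k (g : seq_space k -> R) a b x :
  birkhoff g (a + b) x = birkhoff g a x + birkhoff g b (iter a (@shift k) x).
Proof.
rewrite /birkhoff (big_cat_nat (leq0n a)) ?leq_addr //=; congr (_ + _).
rewrite -{1}[a]add0n big_addn addKn; apply: eq_bigr => i _.
by rewrite iterD.
Qed.

Lemma iter_shiftE k (x : seq_space k) i j : iter i (@shift k) x j = x (i + j)%N.
Proof. by elim: i j => // i IH j; rewrite iterS /shift IH addnS addSn. Qed.

Lemma word_nseq k (x : seq_space k) i n c :
  (forall j, (j < n)%N -> x (i + j)%N = c) -> word x i n = nseq n c.
Proof.
elim: n i => // n IH i H; rewrite wordS /=; congr (_ :: _).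
  by rewrite -(H 0%N) ?addn0.
by apply: IH => j jn; rewrite addSnnS H.
Qed.

Definition block (j : nat) : seq 'I_2 := rcons (nseq j two) one.

Lemma word_block (x : seq_space 1) i j :
  (forall h, (h < j)%N -> x (i + h)%N = two) -> x (i + j)%N = one ->
  word x i j.+1 = block j.
Proof. by move=> H xj; rewrite word_rcons (word_nseq H) xj. Qed.

Definition single_one (j : nat) : seq_space 1 := fun i => if i == j then one else two.

Definition next_one (y : seq_space 1) : option nat :=
  if pselect (exists j, y j.+1 == one) is left ex then Some (ex_minn ex) else None.

Lemma next_one_some y j : next_one y = Some j <->
  y j.+1 = one /\ forall i, (i < j)%N -> y i.+1 = two.
Proof.
rewrite /next_one; case: pselect => [ex|nex]; last first.
  by split => // -[yj _]; case: nex; exists j; rewrite yj.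
case: ex_minnP => h /eqP yh hmin; split => [[<-]|[yj lt2]].
  split => // i ih; apply: neq_one; apply/negP => /hmin.
  by rewrite leqNgt ih.
congr Some; apply/eqP; rewrite eqn_leq hmin ?yj //= leqNgt; apply/negP => /lt2.
by rewrite yh.
Qed.

Lemma next_one_none y : next_one y = None <-> forall j, y j.+1 = two.
Proof.
rewrite /next_one; case: pselect => [ex|nex].
  by split => // H; exfalso; case: ex => j; rewrite H.
by split => // _ j; apply: neq_one; apply/negP => yj; apply: nex; exists j.
Qed.

Lemma next_one_le y k : y k.+1 = one -> exists2 j, (j <= k)%N & next_one y = Some j.
Proof.
case E: (next_one y) => [j|]; last by move/next_one_none: E => ->.
move=> yk; exists j => //; rewrite leqNgt; apply/negP => kj.
by have [_ /(_ k kj)] := (next_one_some _ _).1 E; rewrite yk.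
Qed.

(** The quasi-Bernoulli property, with a constant that may depend on the length
    of the first of the two words. *)
Definition quasi_bernoulli (R : realType) k (X : set (seq_space k))
    (m : seq 'I_k.+1 -> R) (C : nat -> R) :=
  forall y n n', X y -> (0 < n)%N -> (0 < n')%N ->
    expR (- C n) * (m (word y 0 n) * m (word y n n')) <= m (word y 0 (n + n'))
      <= expR (C n) * (m (word y 0 n) * m (word y n n')).

Lemma quasi_mult_ln (R : realType) (a b c t : R) : 0 < a -> 0 < b -> 0 < c ->
  (expR (- t) * (a * b) <= c <= expR t * (a * b)) = (`|ln c - ln a - ln b| <= t).
Proof.
move=> a0 b0 c0; have ab0 : 0 < a * b by rewrite mulr_gt0.
rewrite -ler_ln ?posrE ?mulr_gt0 ?expR_gt0 //.
rewrite -[X in _ && X]ler_ln ?posrE ?mulr_gt0 ?expR_gt0 //.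
rewrite !lnM ?posrE ?expR_gt0 // !expRK ler_norml.
by apply/andP/andP => -[? ?]; split; lra.
Qed.

Section FactorPotential.
Variables (R : realType) (B : 'M[bool]_2) (nu : probability (seq_space 1) R).
Local Notation Y := (sft B).
Local Notation m := (wmeas nu).
Hypothesis B12 : B one two.
Hypothesis B21 : B two one.
Hypothesis B22 : B two two.
Hypothesis m_gt0 : forall y n, Y y -> 0 < m (word y 0 n).
Hypothesis renewal : forall w v,
  m (w ++ one :: v) * m [:: one] = m (rcons w one) * m (one :: v).

Lemma word_factor_gt0 y i n : Y y -> 0 < m (word y i n).
Proof. by move=> Yy; rewrite -[i]addn0 -word_iter_shift m_gt0 //; exact: sft_shift. Qed.

Lemma single_one_in j : Y (single_one j).
Proof.
move=> i; rewrite /single_one; case: (eqVneq i j) => [->|_].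
  by rewrite (gtn_eqF (ltnSn j)).
by case: ifP.
Qed.

Lemma m_block_gt0 j : 0 < m (block j).
Proof.
rewrite -(@word_block (single_one j) 0 j) ?m_gt0 //; first exact: single_one_in.
  by move=> h hj; rewrite /single_one add0n ltn_eqF.
by rewrite /single_one add0n eqxx.
Qed.

(** The logarithm of the g-function of the measure: the conditional probability of
    the first symbol given the later ones, which by [renewal] depends only on the
    position of the next [one].  When there is none, the values are the limits
    that occur if the measures of the runs of [two] decay like [theta ^+ j]. *)
Definition factor_potential (theta : R) (y : seq_space 1) : R :=
  if next_one y is Some j then ln (m (y 0%N :: block j) / m (block j))
  else if y 0%N == one then ln (1 - theta) else ln theta.

Variable theta : R.
Local Notation g := (factor_potential theta).

(** By [renewal] the conditional probability can be read off the word up to any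
    later occurrence of [one], which makes Birkhoff sums telescope. *)
Lemma factor_potentialE y k : Y y -> y k.+1 = one ->
  g y = ln (m (word y 0 k.+2)) - ln (m (word y 1 k.+1)).
Proof.
move=> Yy /next_one_le[j jk E]; rewrite /g E.
have [yj lt2] := (next_one_some _ _).1 E.
have w1 : word y 1 k.+1 = nseq j two ++ one :: word y j.+2 (k - j).
  rewrite -cat_rcons -/(block j) -(@word_block y 1 j) // -word_cat.
  by congr word; rewrite addSn subnKC.
have w0 : word y 0 k.+2 = (y 0%N :: nseq j two) ++ one :: word y j.+2 (k - j).
  by rewrite wordS w1.
have p0 := word_factor_gt0 0 k.+2 Yy; have p1 := word_factor_gt0 1 k.+1 Yy.
have b0 := m_block_gt0 j.
have v0 := word_factor_gt0 j.+1 (k - j).+1 Yy; rewrite wordS yj in v0.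
have o0 : 0 < m [:: one] by exact: (m_block_gt0 0).
have := renewal (y 0%N :: nseq j two) (word y j.+2 (k - j)).
have := renewal (nseq j two) (word y j.+2 (k - j)).
rewrite -w0 -w1 rcons_cons -/(block j) => r1 r0.
rewrite -ln_div ?posrE //; congr ln.
apply/eqP; rewrite eqr_div ?(lt0r_neq0 b0) ?(lt0r_neq0 p1) //; apply/eqP.
by apply: (mulIf (lt0r_neq0 o0)); rewrite -mulrA r1 [RHS]mulrAC r0; ring.
Qed.

Lemma birkhoff_factor_potential y n k : Y y -> (n <= k)%N -> y k = one ->
  birkhoff g n y = ln (m (word y 0 k.+1)) - ln (m (word y n (k - n).+1)).
Proof.
move=> Yy nk yk; pose u i := - ln (m (word y i (k.+1 - i))).
rewrite /birkhoff (eq_big_nat _ _ (F2 := fun i => u i.+1 - u i)).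
  by rewrite telescope_sumr // /u subn0 subSn // opprK addrC.
move=> i /= ik; have {}ik : (i < k)%N by exact: leq_trans nk.
rewrite (@factor_potentialE _ (k - i.+1)); last first.
- by rewrite iter_shiftE -addSnnS subnKC.
- exact: sft_shift.
rewrite !word_iter_shift addn0 addn1 /u opprK addrC.
by rewrite !subSS -!subSn // ltnW.
Qed.

Lemma factor_potential_two : g (fun=> two) = ln theta.
Proof. by rewrite /g (_ : next_one _ = None) //; apply/next_one_none. Qed.

Lemma birkhoff_two p : birkhoff g p (fun=> two) = p%:R * ln theta.
Proof.
rewrite /birkhoff (eq_bigr (fun=> ln theta)) ?sumr_const_nat ?subn0 ?mulr_natl //.
move=> i _; rewrite -factor_potential_two; congr (g _).
by apply/funext => j; rewrite iter_shiftE.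
Qed.

Lemma word_single_one i j : word (single_one (i + j)) i j.+1 = block j.
Proof.
by apply: word_block => [h hj|]; rewrite /single_one ?eqxx // eqn_add2l ltn_eqF.
Qed.

Lemma word_single_one0 j : word (single_one j) 0 j.+1 = block j.
Proof. exact: (word_single_one 0). Qed.

Lemma birkhoff_single_one p M : birkhoff g p (single_one (p + M.+1)) =
  ln (m (block (p + M).+1) / m (block M.+1)).
Proof.
rewrite (@birkhoff_factor_potential _ _ (p + M.+1)%N).
- by rewrite addKn (word_single_one p) word_single_one0 addnS ln_div ?posrE ?m_block_gt0.
- exact: single_one_in.
- exact: leq_addr.
- by rewrite /single_one eqxx.
Qed.

Variables (K : R) (C : nat -> R).
Hypothesis theta01 : 0 < theta < 1.
Hypothesis theta_K : quasi_geometric (fun j => m (block j.+1)) theta K.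
Hypothesis m_quasi_bernoulli : quasi_bernoulli Y m C.

Let quasi_bernoulli_ln y n n' : Y y -> (0 < n)%N -> (0 < n')%N ->
  `|ln (m (word y 0 (n + n'))) - ln (m (word y 0 n)) - ln (m (word y n n'))| <= C n.
Proof.
move=> Yy n0 n0'; rewrite -quasi_mult_ln ?word_factor_gt0 //; exact: m_quasi_bernoulli.
Qed.

Lemma birkhoff_recurrent y n k : Y y -> (0 < n)%N -> (n <= k)%N -> y k = one ->
  `|ln (m (word y 0 n)) - birkhoff g n y| <= C n.
Proof.
move=> Yy n0 nk yk; rewrite (birkhoff_factor_potential Yy nk yk).
have := quasi_bernoulli_ln Yy n0 (ltn0Sn (k - n)).
by rewrite addnS subnKC // -normrN; congr (`|_| <= _); ring.
Qed.

(** The case [n = 1] of the quasi-Bernoulli property. *)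
Lemma potential_at_last_one q :
  `|ln (m (one :: block q.+1) / m (block q.+1))| <= C 1%N + `|ln (m [:: one])|.
Proof.
pose y : seq_space 1 := fun i => if i is j.+1 then single_one q.+1 j else one.
have Yy : Y y by case=> [|i]; [exact: B12|exact: single_one_in].
have wy : word y 1 q.+2 = block q.+1 by rewrite -word_single_one0 -word_shift.
have wy0 : word y 0 q.+3 = one :: block q.+1 by rewrite wordS wy.
have := quasi_bernoulli_ln Yy (ltn0Sn 0) (ltn0Sn q.+1).
rewrite add1n wy0 wy -[word y 0 1]/[:: one] => h.
rewrite ln_div ?posrE ?m_block_gt0 //; last by rewrite -wy0 m_gt0.
move: h; move: (ln (m (one :: _))) (ln (m (block _))) (ln (m [:: one])).
move=> a b c h.
apply: le_trans (lerD h (lexx _)); have -> : a - b = (a - c - b) + c by ring.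
exact: ler_normD.
Qed.

(** If [one] occurs in [y] at an index at least [n], the telescoped Birkhoff sum is
    the logarithm of the ratio that the quasi-Bernoulli property estimates.  Otherwise
    [y] ends with an infinite run of [two]; placing a symbol [one] far out in this
    run reduces to the first case, and the effect on the Birkhoff sum is bounded:
    it is nil before the last [one] of [y], bounded at it, and controlled by
    [theta_K] after it. *)
Lemma factor_potential_bound : exists L, forall y n, Y y -> (0 < n)%N ->
  `|ln (m (word y 0 n)) - birkhoff g n y| <= C n + L.
Proof.
have K0 : 0 <= K by have [M] := theta_K 0; apply: le_trans.
pose L1 := C 1%N + `|ln (m [:: one])| + `|ln (1 - theta)|.
have L10 : 0 <= L1 by rewrite addr_ge0 // (le_trans _ (potential_at_last_one 0)).
exists (K + L1) => y n Yy n0.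
have [[k nk yk]|noone] := pselect (exists2 k, (n <= k)%N & y k = one).
  by apply: le_trans (birkhoff_recurrent Yy n0 nk yk) _; rewrite lerDl addr_ge0.
have tail k : (n <= k)%N -> y k = two.
  by move=> nk; apply: neq_one; apply/eqP => yk; apply: noone; exists k.
have closeness (y' : seq_space 1) k : Y y' -> (n <= k)%N -> y' k = one ->
    word y' 0 n = word y 0 n ->
    `|birkhoff g n y' - birkhoff g n y| <= K + L1 ->
    `|ln (m (word y 0 n)) - birkhoff g n y| <= C n + (K + L1).
  move=> Yy' nk yk wy h; have := birkhoff_recurrent Yy' n0 nk yk; rewrite wy => h'.
  apply: le_trans (lerD h' h).
  set a := ln _; set b := birkhoff g n y; set c := birkhoff g n y'.
  have -> : a - b = (a - c) + (c - b) by ring.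
  exact: ler_normD.
have tail_close p M :
    `|ln (m (block (p + M).+1) / m (block M.+1)) - p%:R * ln theta| <= K ->
    `|birkhoff g p (single_one (p + M.+1)) - birkhoff g p (fun=> two)| <= K.
  by rewrite birkhoff_single_one birkhoff_two.
have [ex|nex] := pselect (exists l, (l < n)%N && (y l == one)); last first.
  have yE : y = (fun=> two).
    apply/funext => i; apply: neq_one; apply/eqP => yi.
    have [ni|ni] := leqP n i; first by apply: noone; exists i.
    by apply: nex; exists i; rewrite ni yi eqxx.
  have [M hM] := theta_K n.
  apply: (closeness (single_one (n + M.+1)) (n + M.+1)%N).
  - exact: single_one_in.
  - exact: leq_addr.
  - by rewrite /single_one eqxx.
  - by apply: word_eqP => j jn; rewrite yE /single_one add0n ltn_eqF // ltn_addr.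
  - by apply: (@le_trans _ _ K); [rewrite yE; exact: tail_close|rewrite lerDl].
have ub l : (l < n)%N && (y l == one) -> (l <= n)%N by case/andP=> /ltnW.
case: (ex_maxnP ex ub) => l /andP[l_n /eqP yl] lmax.
have ltail i : (l < i)%N -> y i = two.
  move=> li; have [ni|ni] := leqP n i; first exact: tail.
  apply: neq_one; apply/negP => yi; have := lmax i; rewrite ni yi => /(_ isT).
  by rewrite leqNgt li.
have [p np] : exists p, n = (l.+1 + p)%N by exists (n - l.+1)%N; rewrite subnKC.
have [M hM] := theta_K p.
pose y' : seq_space 1 := fun i => if i == (n + M.+1)%N then one else y i.
have y'lt i : (i < n + M.+1)%N -> y' i = y i by move=> h; rewrite /y' ltn_eqF.
have y'n : y' (n + M.+1)%N = one by rewrite /y' eqxx.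
have Yy' : Y y'.
  move=> i; rewrite /y'; case: (eqVneq i (n + M.+1)%N) => [->|_].
    rewrite (gtn_eqF (ltnSn _)) tail //; exact: leqW (leq_addr _ _).
  case: ifP => [/eqP|_]; last exact: Yy.
  by rewrite addnS => -[->]; rewrite tail ?leq_addr.
apply: (closeness y' (n + M.+1)%N Yy' (leq_addr _ _) y'n).
  by apply: word_eqP => j jn; rewrite add0n y'lt // ltn_addr.
have shifted (z : seq_space 1) : birkhoff g n z =
    birkhoff g l z + g (iter l (@shift 1) z) + birkhoff g p (iter l.+1 (@shift 1) z).
  by rewrite np birkhoffD -[l.+1]addn1 birkhoffD /birkhoff big_nat1.
have tailE : iter l.+1 (@shift 1) y = (fun=> two).
  by apply/funext => i; rewrite iter_shiftE ltail // ltnS leq_addr.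
have tailE' : iter l.+1 (@shift 1) y' = single_one (p + M.+1).
  apply/funext => i; rewrite iter_shiftE /y' /single_one np -addnA eqn_add2l.
  by case: ifP => // _; rewrite ltail // ltnS leq_addr.
have headE : birkhoff g l y' = birkhoff g l y.
  have y'l : y' l = one by rewrite y'lt ?yl // ltn_addr.
  rewrite (birkhoff_factor_potential Yy' (leqnn l) y'l).
  rewrite (birkhoff_factor_potential Yy (leqnn l) yl).
  rewrite subnn; congr (ln (m _) - ln (m _)); apply: word_eqP => j jl.
    by rewrite y'lt // add0n (leq_trans jl) // (leq_trans l_n) // leq_addr.
  by case: j jl => // _; rewrite addn0 yl y'l.
have lastE : g (iter l (@shift 1) y) = ln (1 - theta).
  rewrite /g (_ : next_one _ = None); first by rewrite iter_shiftE addn0 yl eqxx.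
  by apply/next_one_none => j; rewrite iter_shiftE ltail // addnS ltnS leq_addr.
have lastE' : g (iter l (@shift 1) y') =
    ln (m (one :: block (p + M).+1) / m (block (p + M).+1)).
  rewrite /g (_ : next_one _ = Some (p + M).+1).
    by rewrite iter_shiftE addn0 y'lt ?yl // ltn_addr.
  apply/next_one_some; split.
    by rewrite iter_shiftE -y'n; congr y'; lia.
  move=> i ip; rewrite iter_shiftE y'lt; first by rewrite ltail // addnS ltnS leq_addr.
  by lia.
rewrite !shifted tailE tailE' headE lastE lastE'.
have h1 := tail_close p M hM; have h2 := potential_at_last_one (p + M).
move: h1 h2; rewrite /L1 !ler_norml.
have := ler_norm (ln (1 - theta)); have := ler_norm (- ln (1 - theta)); rewrite normrN.
by move=> ? ? /andP[? ?] /andP[? ?]; apply/andP; split; lra.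
Qed.

End FactorPotential.

Lemma sum_ord2 (V : nmodType) (F : 'I_2 -> V) : \sum_a F a = F one + F two.
Proof. by rewrite !big_ord_recl big_ord0 addr0; congr (F _ + F _); exact: val_inj. Qed.

Section PotentialRegularity.
Variables (R : realType) (nu : probability (seq_space 1) R) (theta : R).
Local Notation m := (wmeas nu).
Local Notation g := (factor_potential nu theta).

Lemma measurable_factor_potential (X : set (seq_space 1)) :
  measurable X -> measurable_fun X g.
Proof.
move=> mX _ U mU; apply: measurableI => //.
have mpos i (P : pred 'I_2) : measurable [set y : seq_space 1 | P (y i)].
  rewrite (_ : [set _ | _] = \big[setU/set0]_(a | P a) [set y : seq_space 1 | y i = a]).
    by apply: bigsetU_measurable => a _; exact: measurable_coord.
  rewrite -bigcup_seq_cond; apply/seteqP; split => [y Py|y [a /= /andP[_ Pa] ->]//].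
  by exists (y i) => //=; rewrite mem_index_enum.
have mnext o : measurable [set y | next_one y = o].
  case: o => [j|].
    rewrite (_ : [set _ | _] = [set y : seq_space 1 | y j.+1 = one] `&`
       \bigcap_(i in [set i | (i < j)%N]) [set y | y i.+1 = two]).
      apply: measurableI; first exact: measurable_coord.
      by apply: bigcap_measurableType => i _; exact: measurable_coord.
    by apply/seteqP; split => y /next_one_some.
  rewrite (_ : [set _ | _] = \bigcap_i [set y | y i.+1 = two]).
    by apply: bigcapT_measurable => i; exact: measurable_coord.
  apply/seteqP; split => y; first by move=> /next_one_none H i _; exact: H.
  by move=> H; apply/next_one_none => i; exact: H.
pose F (q : 'I_2 * option nat) : R :=
  if q.2 is Some j then ln (m (q.1 :: block j) / m (block j))
  else if q.1 == one then ln (1 - theta) else ln theta.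
rewrite (_ : g @^-1` U = \bigcup_(q in F @^-1` U)
   ([set y : seq_space 1 | y 0%N = q.1] `&` [set y | next_one y = q.2])); last first.
  apply/seteqP; split => [y Uy|y [[a o] /= UF [ya yo]]].
    by exists (y 0%N, next_one y).
  by move: UF; rewrite /F /factor_potential /= yo ya.
rewrite bigcup_mkcond; apply: countable_bigcupT_measurable => // q.
case: ifP => _ //; apply: measurableI => //; exact: measurable_coord.
Qed.

Hypothesis im : invariant_words m.
Hypothesis m_block_gt0 : forall j, 0 < m (block j).
Hypothesis theta01 : 0 < theta < 1.
Hypothesis ratio_cvg : (fun j => m (block j.+2) / m (block j.+1)) @ \oo --> theta.

(** Away from the points that read [two] from the second symbol on the potential is
    locally constant.  At such a point its nearby values are the logarithms of the
    conditional probabilities before long runs, and these converge: the one of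
    [two] to [theta], hence the one of [one] to [1 - theta]. *)
Lemma continuous_factor_potential (X : set (seq_space 1)) :
  {within X, continuous g}.
Proof.
have /andP[t0 t1] := theta01.
pose val a j := ln (m (a :: block j) / m (block j)).
have ratio2 : (fun j => m (two :: block j) / m (block j)) @ \oo --> theta.
  by rewrite -(cvg_shiftS (fun j => m (two :: block j) / m (block j))).
have valc a : val a j @[j --> \oo] --> (if a == one then ln (1 - theta) else ln theta).
  case: (ord2P a) => ->; rewrite /val /=; last first.
    by apply: (cvg_comp _ _ ratio2); exact: continuous_ln.
  have E : (fun j => m (one :: block j) / m (block j)) =
           (fun j => 1 - m (two :: block j) / m (block j)).
    apply/funext => j; have [_ _ /(_ (block j)) + _] := im; rewrite sum_ord2 => h.
    have b0 := m_block_gt0 j; rewrite -{1 2}h.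
    by field; rewrite h gt_eqF.
  have r1 : (fun j => m (one :: block j) / m (block j)) @ \oo --> 1 - theta.
    by rewrite E; apply: cvgB => //; exact: cvg_cst.
  apply: (cvg_comp _ _ r1); apply: continuous_ln; lra.
apply/subspace_continuousP => x Xx.
case E: (next_one x) => [j|].
  apply: cvg_near_cst; apply: filterS (nbhs_cylinder x j.+2) => y [_].
  rewrite size_word => yx Xy; rewrite /from_subspace /factor_potential E.
  have yE i : (i < j.+2)%N -> y i = x i by move=> /(word_inj yx).
  have [xj xlt] := (next_one_some _ _).1 E.
  have -> : next_one y = Some j.
    apply/next_one_some; split; first by rewrite yE.
    by move=> i ij; rewrite yE ?xlt // ltnS ltnW.
  by rewrite yE.
apply/cvgrPdist_le => eps eps0.
have /cvgrPdist_le/(_ eps eps0)[N _ HN] := valc (x 0%N).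
apply: filterS (nbhs_cylinder x N.+1) => y [_]; rewrite size_word => yx Xy.
have yE i : (i < N.+1)%N -> y i = x i by move=> /(word_inj yx).
have xtwo := (next_one_none _).1 E.
rewrite /from_subspace /factor_potential E; case Ey: (next_one y) => [j|]; last by rewrite yE // subrr normr0 ltW.
rewrite yE //; apply: HN => /=; rewrite leqNgt; apply/negP => jN.
have [yj _] := (next_one_some _ _).1 Ey.
by have := xtwo j; rewrite -yE // yj.
Qed.

End PotentialRegularity.

(** * Gibbs property and uniqueness for the factor measure *)

Section FactorGibbs.
Variables (R : realType) (B : 'M[bool]_2) (nu : probability (seq_space 1) R).
Local Notation Y := (sft B).
Local Notation m := (wmeas nu).
Hypothesis B12 : B one two.
Hypothesis B21 : B two one.
Hypothesis B22 : B two two.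
Hypothesis inv : shift_invariant Y nu.
Hypothesis m_gt0 : forall y n, Y y -> 0 < m (word y 0 n).
Hypothesis renewal : forall w v,
  m (w ++ one :: v) * m [:: one] = m (rcons w one) * m (one :: v).
Variables (theta K : R) (C : nat -> R).
Local Notation g := (factor_potential nu theta).
Hypothesis theta01 : 0 < theta < 1.
Hypothesis theta_K : quasi_geometric (fun j => m (block j.+1)) theta K.
Hypothesis C_sub : (fun n => C n / n%:R) @ \oo --> (0 : R).
Hypothesis m_quasi_bernoulli : quasi_bernoulli Y m C.

Let im : invariant_words m := wmeas_invariant inv.
Let m0 w : 0 <= m w. Proof. by case: im. Qed.

Lemma factor_potential_gibbs : exists L,
  gibbs_bounds Y g nu 0 (fun n => expR (C n + L)).
Proof.
have [L HL] := factor_potential_bound B12 B21 B22 m_gt0 renewal theta01 theta_K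
  m_quasi_bernoulli.
exists L => y n Yy n0; rewrite wmeas_carried; [|exact: measurable_sft|by case: inv].
rewrite mulr0 oppr0 add0r -(lnK (m_gt0 n Yy)) -expRN -expRB !ler_expR.
by have := HL _ _ Yy n0; rewrite ler_norml => /andP[? ?]; apply/andP; split; lra.
Qed.

(** Before a run of [two] the symbol [one] has a conditional probability bounded
    below, by the quasi-Bernoulli property for a first word of length one. *)
Lemma run_decay : exists2 q, 0 < q < 1 & forall n, m (nseq n.+1 two) <= q ^+ n.
Proof.
have o0 : 0 < m [:: one] by exact: (m_block_gt0 B12 B21 B22 m_gt0 0).
pose y : seq_space 1 := single_one 0.
have Yy : Y y by exact: single_one_in.
have wy n : word y 1 n = nseq n two by apply: word_nseq.
have step n : m (nseq n.+2 two) <= (1 - expR (- C 1%N) * m [:: one]) * m (nseq n.+1 two).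
  have /andP[+ _] := m_quasi_bernoulli Yy (ltn0Sn 0) (ltn0Sn n).
  rewrite add1n [word y 0 n.+2]wordS wy -[word y 0 1]/[:: one] => h.
  have [_ _ /(_ (nseq n.+1 two)) + _] := im; rewrite sum_ord2 => E.
  by rewrite -[nseq n.+2 two]/(two :: nseq n.+1 two) mulrBl mul1r -mulrA; lra.
pose q' := 1 - expR (- C 1%N) * m [:: one].
have d0 : 0 < expR (- C 1%N) * m [:: one] by rewrite mulr_gt0 ?expR_gt0.
have q'1 : q' < 1 by rewrite /q'; lra.
exists (Num.max (1 / 2) q').
  by rewrite lt_max gt_max q'1 divr_gt0 //= andbT; lra.
elim => [|n IH].
  rewrite expr0; have [m1 _ _ _] := im; rewrite -m1.
  exact: (inv_le_catr im [::] _).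
apply: le_trans (step n) _; rewrite exprS.
apply: (@le_trans _ _ (Num.max (1 / 2) q' * m (nseq n.+1 two))).
  by apply: ler_wpM2r => //; rewrite le_max lexx orbT.
by apply: ler_wpM2l => //; rewrite le_max divr_ge0.
Qed.

Section Uniqueness.
Variables (nu' : probability (seq_space 1) R) (c : nat -> R).
Local Notation m' := (wmeas nu').
Hypothesis inv' : shift_invariant Y nu'.
Hypothesis m'_gt0 : 0 < m' [:: one].
Hypothesis m'_le : forall w, w != [::] -> m' w <= expR (c (size w)) * m w.
Hypothesis c_sub : (fun n => c n / n%:R) @ \oo --> (0 : R).

Let im' : invariant_words m' := wmeas_invariant inv'.
Let m'0 w : 0 <= m' w. Proof. by case: im'. Qed.
Let t := m' [:: one] / m [:: one].

Let o0 : 0 < m [:: one].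
Proof. exact: (m_block_gt0 B12 B21 B22 m_gt0 0). Qed.

(** By [renewal] the conditional probabilities given a word that contains [one]
    do not change when the word is extended, so [rigidity] applies to them. *)
Lemma proportional_ending_one u : m' (rcons u one) = t * m (rcons u one).
Proof.
elim: u => [|a u IH]; first by rewrite /t divfK // gt_eqF.
have r0 : rcons u one != [::] by case: (u).
have ren v : m (a :: rcons u one ++ v) * m (rcons u one) =
             m (a :: rcons u one) * m (rcons u one ++ v).
  apply: (mulIf (lt0r_neq0 o0)).
  have := renewal (a :: u) v; have := renewal u v.
  rewrite !cat_rcons -!rcons_cons -!cat_cons => h1 h2.
  by rewrite mulrAC h2 -mulrA -mulrA h1; ring.
have := rigidity im' m0 (fun w _ => (_ : \sum_a m (a :: w) = m w)) m'_le c_sub r0 ren.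
have [_ _ ml _] := im => /(_ ml).
have [u0|u0] := eqVneq (m (rcons u one)) 0.
  move=> _; rewrite rcons_cons.
  have -> : m (a :: rcons u one) = 0.
    by apply/le_anti; rewrite m0 andbT -u0; exact: (inv_le_catl im [:: a]).
  apply/le_anti; rewrite mulr0 m'0 andbT.
  apply: le_trans (inv_le_catl im' [:: a] (rcons u one)) _.
  by rewrite IH u0 mulr0.
by rewrite rcons_cons => h; apply: (mulIf u0); rewrite h IH; ring.
Qed.

Lemma defect_run k : m' (nseq k two) = (1 - t) + t * m (nseq k two).
Proof.
elim: k => [|k IH].
  by have [-> _ _ _] := im; have [-> _ _ _] := im'; rewrite mulr1 subrK.
have nS : nseq k.+1 two = rcons (nseq k two) two by elim: k {IH} => //= k <-.
have [_ _ _ /(_ (nseq k two)) + ] := im; have [_ _ _ /(_ (nseq k two)) + ] := im'.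
rewrite !sum_ord2 -nS proportional_ending_one IH => h1 h2.
have -> : m (nseq k.+1 two) = m (nseq k two) - m (rcons (nseq k two) one).
  by rewrite -h2; ring.
by apply/eqP; rewrite -(inj_eq (addrI (t * m (rcons (nseq k two) one)))) h1; apply/eqP; ring.
Qed.

(** The defect [1 - t] is the same on all runs of [two].  If negative it would make
    the measure of a long run negative; if positive it would exceed the bound
    [m'_le], as [m] is exponentially small on these runs. *)
Lemma proportionality_one : t = 1.
Proof.
have [q /andP[q0 q1] mq] := run_decay.
have lnq : ln q < 0 by rewrite -ln1 ltr_ln ?posrE.
have t0 : 0 < t by rewrite divr_gt0.
have mk k : 0 < m (nseq k.+1 two).
  rewrite -(@word_nseq _ (single_one k.+1) 0 k.+1).
    by rewrite m_gt0 //; exact: single_one_in.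
  by move=> j jk; rewrite /single_one add0n ltn_eqF.
have lnmk k : ln (m (nseq k.+1 two)) <= k%:R * ln q.
  by rewrite mulr_natl -lnXn // ler_ln ?posrE ?exprn_gt0.
apply/le_anti/andP; split.
  rewrite -subr_le0 leNgt; apply/negP => s0.
  have : - ln q <= 0.
    apply: (@sublinear_slope_le0 _ (fun=> 0) _ (ln ((t - 1) / t)) 0) => [|k].
      exact: cvg_cst_over_n.
    have := m'0 (nseq k.+1 two); rewrite defect_run => h.
    have : ln ((t - 1) / t) <= ln (m (nseq k.+1 two)).
      rewrite ler_ln ?posrE ?divr_gt0 // ler_pdivrMr //; lra.
    by have := lnmk k; lra.
  by rewrite oppr_le0 leNgt lnq.
rewrite -subr_le0 leNgt; apply/negP => s0.
have : - ln q <= 0.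
  apply: (@sublinear_slope_le0 _ c _ (ln (1 - t)) 1) => // k.
  have h := m'_le (isT : nseq k.+1 two != [::]).
  rewrite size_nseq defect_run in h.
  have : 1 - t <= expR (c k.+1) * m (nseq k.+1 two).
    by apply: le_trans h; rewrite lerDl mulr_ge0 // ltW.
  rewrite -ler_ln ?posrE ?mulr_gt0 ?expR_gt0 // lnM ?posrE ?expR_gt0 // expRK add1n.
  by have := lnmk k; lra.
by rewrite oppr_le0 leNgt lnq.
Qed.

Lemma words_unique w : m' w = m w.
Proof.
elim/last_ind: w => [|w a IH]; first by have [-> _ _ _] := im; have [-> _ _ _] := im'.
case: (ord2P a) => ->; first by rewrite proportional_ending_one proportionality_one mul1r.
have [_ _ _ /(_ w) + ] := im; have [_ _ _ /(_ w) + ] := im'.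
by rewrite !sum_ord2 proportional_ending_one proportionality_one mul1r IH => <- /addrI ->.
Qed.

End Uniqueness.

(** Two weak Gibbs measures of one potential differ on words of length [n] by the
    factor [expR (- n * P)] up to subexponential terms, [P] being the difference
    of the pressures; summing over words shows that [P] is nonnegative. *)
Lemma factor_weak_gibbs_unique nu' : shift_invariant Y nu' -> weak_gibbs Y g nu' ->
  forall D, measurable D -> nu' D = nu D.
Proof.
move=> inv' [P [C' [C'0 C'_sub gb']]].
have [L gb] := factor_potential_gibbs.
have im' := wmeas_invariant inv'.
have m'0 w : 0 <= wmeas nu' w by case: im'.
pose c n := ln (C' n) + (C n + L).
have c_sub : (fun n => c n / n%:R) @ \oo --> (0 : R).
  rewrite (_ : (fun _ => _) =
    (fun n => ln (C' n) / n%:R + (C n / n%:R + L / n%:R))); last first.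
    by apply/funext => n; rewrite /c !mulrDl.
  rewrite -[X in _ --> X](addr0 0); apply: cvgD => //.
  rewrite -[X in _ --> X](addr0 0); apply: cvgD => //; exact: cvg_cst_over_n.
have nY w : ~ (exists2 y, Y y & word y 0 (size w) = w) ->
    forall mu : probability (seq_space 1) R, shift_invariant Y mu -> wmeas mu w = 0.
  move=> nex mu [mu1 _]; rewrite -(wmeas_carried _ (measurable_sft B) mu1).
  rewrite (_ : cylinder Y w = set0) ?measure0 //.
  by apply/seteqP; split => // y [Yy yw]; apply: nex; exists y.
have cmp w : w != [::] ->
   expR (- c (size w) - (size w)%:R * P) * m w <= wmeas nu' w <=
   expR (c (size w) - (size w)%:R * P) * m w.
  move=> w0.
  have [[y Yy yw]|nex] := pselect (exists2 y, Y y & word y 0 (size w) = w); last first.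
    by rewrite (nY w nex nu inv) (nY w nex nu' inv') !mulr0 lexx.
  have n0 : (0 < size w)%N by rewrite lt0n size_eq0.
  have := gb _ _ Yy n0; have := gb' _ _ Yy n0.
  have [nu1 _] := inv; have [nu'1 _] := inv'.
  rewrite (wmeas_carried _ (measurable_sft B) nu1).
  rewrite (wmeas_carried _ (measurable_sft B) nu'1).
  have c'0 := C'0 _ n0.
  rewrite yw mulr0 oppr0 add0r -(lnK c'0) -!(expRN (ln _)) -(expRN (C _ + L)).
  move=> /andP[l' u'] /andP[l u].
  rewrite ler_pdivlMr ?expR_gt0 // -expRD in l'.
  rewrite ler_pdivlMr ?expR_gt0 // -expRD in l.
  rewrite ler_pdivrMr ?expR_gt0 // -expRD in u'.
  rewrite ler_pdivrMr ?expR_gt0 // -expRD in u.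
  apply/andP; split.
    apply: le_trans _ l'; apply: le_trans (ler_wpM2l (expR_ge0 _) u) _.
    by rewrite -!expRD ler_expR /c; lra.
  apply: le_trans u' _; apply: le_trans _ (ler_wpM2l (expR_ge0 _) l).
  by rewrite -!expRD ler_expR /c; lra.
have c_total n : \sum_(v : n.+1.-tuple 'I_2) expR (- c n.+1 - n.+1%:R * P) * m v <= 1.
  rewrite -[leRHS](inv_sum im' n.+1); apply: ler_sum => v _.
  have v0 : v != [::] :> seq _ by case/tupleP: v.
  by have /andP[+ _] := cmp _ v0; rewrite size_tuple.
have P0 : 0 <= P.
  rewrite -oppr_le0; apply: (@sublinear_slope_le0 _ c _ (- P) 1) => // n.
  have := c_total n; rewrite -mulr_sumr (inv_sum im) mulr1 -[leRHS]expR0 ler_expR.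
  by rewrite -natr1 add1n; lra.
have o1 : [:: one] != [::] :> seq 'I_2 by [].
have o0 : 0 < m [:: one] by exact: (m_block_gt0 B12 B21 B22 m_gt0 0).
apply: measure_eq_cylinder => w; rewrite !wmeasE; congr EFin.
apply: (@words_unique nu' c) => //.
- by have /andP[h _] := cmp _ o1; apply: lt_le_trans h; rewrite mulr_gt0 ?expR_gt0.
- move=> v v0; have /andP[_ h] := cmp _ v0; apply: le_trans h _.
  by apply: ler_wpM2r => //; rewrite ler_expR lerBlDr lerDl mulr_ge0.
Qed.

End FactorGibbs.

Lemma gibbs_weak_gibbs (R : realType) k (X : set (seq_space k)) g
    (mu : probability (seq_space k) R) : gibbs X g mu -> weak_gibbs X g mu.
Proof.
move=> [P [C [C0 gb]]]; exists P, (fun=> C); split => //.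
exact: cvg_cst_over_n.
Qed.

Section FactorAssertion.
Variables (R : realType) (B : 'M[bool]_2) (nu : probability (seq_space 1) R).
Local Notation Y := (sft B).
Local Notation m := (wmeas nu).
Hypothesis B12 : B one two.
Hypothesis B21 : B two one.
Hypothesis B22 : B two two.
Hypothesis inv : shift_invariant Y nu.
Hypothesis m_gt0 : forall y n, Y y -> 0 < m (word y 0 n).
Hypothesis renewal : forall w v,
  m (w ++ one :: v) * m [:: one] = m (rcons w one) * m (one :: v).

Variables (F : nat -> seq_space 1 -> R) (P D : R).
Hypothesis F_cont : positive_continuous Y F.
Hypothesis D_gt0 : 0 < D.
Hypothesis F_m : forall y n, Y y -> (0 < n)%N ->
  D^-1 * (expR (n%:R * P) * m (word y 0 n)) <= F n y <=
  D * (expR (n%:R * P) * m (word y 0 n)).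

Let F_gt0 y n : Y y -> (0 < n)%N -> 0 < F n y.
Proof. by move=> Yy n0; have [_] := F_cont n0; apply. Qed.

Let m_gt0' y i n : Y y -> 0 < m (word y i n).
Proof. exact: word_factor_gt0 m_gt0 y i n. Qed.

(* In logarithmic form all the bounds below are linear. *)
Let lnF_m y n : Y y -> (0 < n)%N ->
  `|ln (F n y) - n%:R * P - ln (m (word y 0 n))| <= ln D.
Proof.
move=> Yy n0; have := F_m Yy n0; rewrite -{1 2}(lnK D_gt0) -expRN.
by rewrite quasi_mult_ln ?expR_gt0 ?m_gt0 ?F_gt0 // expRK.
Qed.

Let additive_ln C : additive_bounds Y F C <->
  forall x n n', Y x -> (0 < n)%N -> (0 < n')%N ->
  `|ln (F (n + n')%N x) - ln (F n x) - ln (F n' (iter n (@shift 1) x))| <= C n.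
Proof.
split=> H x n n' Yx n0 n0'; have := H x n n' Yx n0 n0';
  by rewrite quasi_mult_ln ?F_gt0 ?addn_gt0 ?n0 //; exact: sft_shift.
Qed.

Lemma additive_quasi_bernoulli C : additive_bounds Y F C ->
  quasi_bernoulli Y m (fun n => C n + 3 * ln D).
Proof.
move=> /additive_ln H x n n' Yx n0 n0'; rewrite quasi_mult_ln ?m_gt0 ?m_gt0' //.
have nn0 : (0 < n + n')%N by rewrite addn_gt0 n0.
have := H x n n' Yx n0 n0'; have := lnF_m Yx n0; have := lnF_m Yx nn0.
have := lnF_m (sft_shift n Yx) n0'; rewrite word_iter_shift addn0 natrD.
rewrite !ler_norml => /andP[? ?] /andP[? ?] /andP[? ?] /andP[? ?].
by apply/andP; split; lra.
Qed.

Lemma gibbs_almost_additive g : gibbs Y g nu -> almost_additive Y F.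
Proof.
move=> [Q [C [C0 gb]]]; split => //.
have lnm y n : Y y -> (0 < n)%N ->
    `|ln (m (word y 0 n)) - (- (n%:R * Q) + birkhoff g n y)| <= ln C.
  move=> Yy n0; have := gb y n Yy n0; have [nu1 _] := inv.
  rewrite (wmeas_carried _ (measurable_sft B) nu1) -{1 2}(lnK C0) -expRN.
  rewrite ler_pdivlMr ?expR_gt0 // ler_pdivrMr ?expR_gt0 //.
  have := quasi_mult_ln (ln C) ltr01
    (expR_gt0 (- (n%:R * Q) + birkhoff g n y)) (m_gt0 n Yy).
  by rewrite !mul1r ln1 subr0 expRK => ->.
exists (3 * (`|ln D| + `|ln C|) + 1).
  by rewrite ltr_pwDr // mulr_ge0 // addr_ge0.
apply/additive_ln => x n n' Yx n0 n0'.
have nn0 : (0 < n + n')%N by rewrite addn_gt0 n0.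
have Yn := sft_shift n Yx.
have := lnF_m Yn n0'; have := lnF_m Yx n0; have := lnF_m Yx nn0.
have := lnm _ _ Yn n0'; have := lnm _ _ Yx n0; have := lnm _ _ Yx nn0.
rewrite birkhoffD natrD !mulrDl.
have := ler_norm (ln D); have := ler_norm (ln C) => hC hD.
rewrite !ler_norml => /andP[? ?] /andP[? ?] /andP[? ?] /andP[? ?] /andP[? ?] /andP[? ?].
by apply/andP; split; lra.
Qed.

Variable cls : (seq_space 1 -> R) -> Prop.
Hypothesis cls_potential : forall C, quasi_bernoulli Y m C ->
  exists theta K, [/\ 0 < theta < 1,
    quasi_geometric (fun j => m (block j.+1)) theta K &
    cls (factor_potential nu theta)].

Lemma factor_assertion : gibbs_assertion Y F nu cls.
Proof.
split; first (split; last by move=> [g _ [_ Gg _]]; exact: gibbs_almost_additive Gg).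
  move=> [_ [C C0 /additive_quasi_bernoulli qb]].
  have [theta [K [t01 tK clsg]]] := cls_potential qb.
  exists (factor_potential nu theta) => //; split => //.
    have [L gb] := factor_potential_gibbs B12 B21 B22 inv m_gt0 renewal t01 tK qb.
    by exists 0, (expR (C + 3 * ln D + L)); split => //; exact: expR_gt0.
  move=> nu' inv' /gibbs_weak_gibbs.
  exact: (factor_weak_gibbs_unique B12 B21 B22 inv m_gt0 renewal t01 tK (cvg_cst_over_n _) qb).
move=> [_ [C [C0 C_sub /additive_quasi_bernoulli qb]]].
have sub c : (fun n => (C n + c) / n%:R) @ \oo --> (0 : R).
  rewrite (_ : (fun _ => _) = (fun n => C n / n%:R + c / n%:R)); last first.
    by apply/funext => n; rewrite mulrDl.
  by rewrite -[X in _ --> X](addr0 0); apply: cvgD => //; exact: cvg_cst_over_n.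
have [theta [K [t01 tK clsg]]] := cls_potential qb.
exists (factor_potential nu theta) => //; split => //.
  have [L gb] := factor_potential_gibbs B12 B21 B22 inv m_gt0 renewal t01 tK qb.
  exists 0, (fun n => expR (C n + 3 * ln D + L)).
  split => //; first by move=> n _; exact: expR_gt0.
    rewrite (_ : (fun n => ln (expR (C n + 3 * ln D + L)) / n%:R) =
      (fun n => (C n + (3 * ln D + L)) / n%:R)) //.
    by apply/funext => n; rewrite expRK addrA.
exact: (factor_weak_gibbs_unique B12 B21 B22 inv m_gt0 renewal t01 tK (sub _) qb).
Qed.

(** The ratio is the conditional probability of [two] before a run of [two]; the
    quasi-Bernoulli property bounds it and that of [one] from below. *)
Lemma block_ratio_bounds C : quasi_bernoulli Y m C ->
  exists lo hi, [/\ 0 < lo, hi < 1 & forall j, lo <= m (block j.+2) / m (block j.+1) <= hi].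
Proof.
have b0 := m_block_gt0 B12 B21 B22 m_gt0.
move=> qb; have t0 : 0 < m [:: two].
  rewrite -[[:: two]]/(word (single_one 1) 0 1) m_gt0 //; exact: single_one_in.
exists (expR (- C 1%N) * m [:: two]), (1 - expR (- C 1%N) * m [:: one]); split.
- by rewrite mulr_gt0 ?expR_gt0.
- by rewrite ltrBlDr ltrDl mulr_gt0 ?expR_gt0 //; exact: (b0 0%N).
move=> j; rewrite ler_pdivlMr // ler_pdivrMr //.
have h1 : expR (- C 1%N) * (m [:: two] * m (block j.+1)) <= m (block j.+2).
  have /andP[+ _] := qb (single_one j.+2) 1 j.+2 (single_one_in B12 B21 B22 _) isT isT.
  by rewrite add1n word_single_one0 (word_single_one 1 j.+1).
have h2 : expR (- C 1%N) * (m [:: one] * m (block j.+1)) <= m (one :: block j.+1).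
  pose y : seq_space 1 := fun i => if i is i'.+1 then single_one j.+1 i' else one.
  have Yy : Y y by case=> [|i]; [exact: B12|exact: single_one_in].
  have wy : word y 1 j.+2 = block j.+1 by rewrite -word_single_one0 -word_shift.
  have /andP[+ _] := qb y 1 j.+2 Yy isT isT.
  by rewrite add1n [word y 0 j.+3]wordS wy.
have [_ _ /(_ (block j.+1)) + _] := wmeas_invariant inv; rewrite sum_ord2.
rewrite -[two :: block j.+1]/(block j.+2) => E.
by rewrite mulrBl mul1r -!mulrA; apply/andP; split; lra.
Qed.

End FactorAssertion.

(** * The sequence associated to the relative pressure *)

Section RelativePressureBounds.
Variables (R : realType) (k l : nat) (A : 'M[bool]_k.+1) (p : 'I_k.+1 -> 'I_l.+1).
Variables (f : seq_space k -> R) (mu : probability (seq_space k) R) (P C : R).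
Local Notation X := (sft A).
Local Notation m := (wmeas mu).
Hypothesis inv : shift_invariant X mu.
Hypothesis C_gt0 : 0 < C.
Hypothesis gb : gibbs_bounds X f mu P (fun=> C).

Let im : invariant_words m := wmeas_invariant inv.
Let m0 w : 0 <= m w. Proof. by case: im. Qed.

Let live n y (w : n.-tuple 'I_k.+1) := (map p w == word y 0 n) && (0 < m w).

Let blocks_gt0 n w : blocks X n w -> size w = n /\ 0 < m w.
Proof.
case=> x Xx [i ->]; rewrite size_word; split => //.
rewrite -[i]addn0 -word_iter_shift.
by apply: (word_gt0 inv C_gt0 gb); exact: sft_shift.
Qed.

Let live_blocks n y (w : n.-tuple 'I_k.+1) : live y w ->
  exists2 x, X x & word x 0 n = w.
Proof. by case/andP=> _ /(gt0_word inv)[x Xx]; rewrite size_tuple; exists x. Qed.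

(** A selector meets every cylinder lying over the given word of the factor in a
    single point, so its sum runs over these cylinders. *)
Lemma selector_sum n y E : selector X p n y E -> (0 < n)%N ->
  C^-1 * (expR (n%:R * P) * fibre_sum p (word y 0 n) m) <=
  \sum_(x \in E) expR (birkhoff f n x) <=
  C * (expR (n%:R * P) * fibre_sum p (word y 0 n) m).
Proof.
move=> [EX Eu] n0.
pose s (w : n.-tuple 'I_k.+1) := xget point [set x | E x /\ cylinder X w x].
have sP (w : n.-tuple 'I_k.+1) : live y w -> E (s w) /\ cylinder X w (s w).
  move=> lw; have [x Xx xw] := live_blocks lw; case/andP: lw => /eqP pw _.
  have bw : blocks X n w by exists x => //; exists 0%N.
  have [z [zE _]] := Eu w bw pw.
  exact: (@xgetI _ _ [set x | E x /\ cylinder X w x] z zE).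
have sw (w : n.-tuple 'I_k.+1) : live y w -> word (s w) 0 n = w.
  by case/sP => _ [_]; rewrite size_tuple.
have EE : E = s @` [set` live y].
  apply/seteqP; split => [x Ex|_ [w lw <-]]; last by case: (sP w lw).
  have [Xx px] := EX x Ex.
  have sz : size (word x 0 n) == n by rewrite size_word.
  have lw : live y (Tuple sz) by rewrite /live /= px eqxx (word_gt0 inv C_gt0 gb).
  exists (Tuple sz) => //; have [x' xw] := live_blocks lw.
  have bw : blocks X n (word x 0 n) by exists x => //; exists 0%N.
  have [z [_ zu]] := Eu _ bw px.
  transitivity z; first by apply/esym/zu; exact: sP lw.
  by apply: zu; split => //; split => //; rewrite size_word.
have -> : \sum_(x \in E) expR (birkhoff f n x) =
    \sum_(w : n.-tuple 'I_k.+1 | live y w) expR (birkhoff f n (s w)).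
  rewrite {1}EE fsbig_image; last first.
    move=> w w' /set_mem lw /set_mem lw' ss; apply: val_inj.
    by rewrite /= -(sw w lw) -(sw w' lw') ss.
  rewrite [RHS]bigfs ?index_enum_uniq //.
  by move=> w _; rewrite mem_index_enum.
have -> : fibre_sum p (word y 0 n) m = \sum_(w : n.-tuple 'I_k.+1 | live y w) m w.
  rewrite /fibre_sum size_word big_mkcondr; apply: eq_bigr => w _.
  by case: ltP => // mw; apply/le_anti; rewrite mw m0.
rewrite !mulr_sumr; apply/andP; split; apply: ler_sum => w lw.
all: have [Es [Xs _]] := sP w lw; have /andP[] := gibbs_word inv gb Xs n0.
all: rewrite (sw w lw).
all: have -> : expR (birkhoff f n (s w)) =
  expR (n%:R * P) * expR (- (n%:R * P) + birkhoff f n (s w)).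
1,3: by rewrite -expRD; congr expR; ring.
all: move=> h1 h2; rewrite mulrCA ler_wpM2l ?expR_ge0 //.
  by rewrite ler_pdivrMl.
by rewrite -ler_pdivrMl.
Qed.

Lemma selector_exists n y : exists E, selector X p n y E.
Proof.
exists [set xget point (cylinder X w) | w in [set w : n.-tuple 'I_k.+1 | live y w]].
have cP (w : n.-tuple 'I_k.+1) : live y w -> cylinder X w (xget point (cylinder X w)).
  move=> lw; have [x Xx xw] := live_blocks lw.
  by apply: (@xgetI _ _ _ x); split => //; rewrite size_tuple.
split.
  move=> _ [w lw <-]; have [Xx] := cP w lw; rewrite size_tuple => ->.
  by split => //; case/andP: lw => /eqP.
move=> w bw pw; have [sz mw] := blocks_gt0 bw.
have lw : live y (Tuple (introT eqP sz)) by rewrite /live /= pw eqxx.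
exists (xget point (cylinder X w)); split.
  by split; [exists (Tuple (introT eqP sz))|exact: cP lw].
move=> _ [[w' lw' <-] [_]].
have [_] := cP w' lw'; rewrite sz size_tuple => -> <-.
by [].
Qed.

Lemma relative_g_bounds n y : (0 < n)%N ->
  C^-1 * (expR (n%:R * P) * fibre_sum p (word y 0 n) m) <=
  relative_g X p f n y <=
  C * (expR (n%:R * P) * fibre_sum p (word y 0 n) m).
Proof.
move=> n0; have [E sE] := selector_exists n y.
have /andP[lE uE] := selector_sum sE n0.
set S := [set \sum_(x \in E') expR (birkhoff f n x) | E' in selector X p n y].
have ubS : ubound S (C * (expR (n%:R * P) * fibre_sum p (word y 0 n) m)).
  by move=> _ [E' sE' <-]; have /andP[] := selector_sum sE' n0.
have SE : S (\sum_(x \in E) expR (birkhoff f n x)) by exists E.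
apply/andP; split.
  apply: le_trans lE _; apply: ub_le_sup => //.
  by exists (C * (expR (n%:R * P) * fibre_sum p (word y 0 n) m)).
by apply: ge_sup => //; exists (\sum_(x \in E) expR (birkhoff f n x)).
Qed.

End RelativePressureBounds.

Lemma relative_g_word (R : realType) k l (X : set (seq_space k)) (p : 'I_k.+1 -> 'I_l.+1)
    (f : seq_space k -> R) n y y' :
  word y 0 n = word y' 0 n -> relative_g X p f n y = relative_g X p f n y'.
Proof. by move=> yy'; rewrite /relative_g /selector yy'. Qed.

(** * The factor of a Markov measure in which one symbol has a single preimage *)

Section Factor.
Variables (R : realType) (A : 'M[bool]_3) (B : 'M[bool]_2) (p : 'I_3 -> 'I_2).
Variables (f : seq_space 2 -> R) (mu : probability (seq_space 2) R) (P C : R).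
Local Notation X := (sft A).
Local Notation Y := (sft B).
Local Notation m := (wmeas mu).
Local Notation nu := (distribution mu (one_block p)).
Local Notation mnu := (wmeas nu).
Local Notation s1 := (@Ordinal 3 0 isT).
Local Notation s2 := (@Ordinal 3 1 isT).
Local Notation s3 := (@Ordinal 3 2 isT).
Local Notation t := (trans A f mu P).
Hypothesis piX : one_block p @` X = Y.
Hypothesis p1 : p s1 = one.
Hypothesis p2 : p s2 = two.
Hypothesis p3 : p s3 = two.
Hypothesis B12 : B one two.
Hypothesis B21 : B two one.
Hypothesis B22 : B two two.
Hypothesis inv : shift_invariant X mu.
Hypothesis C_gt0 : 0 < C.
Hypothesis gb : gibbs_bounds X f mu P (fun=> C).

Let im : invariant_words m := wmeas_invariant inv.
Let m0 w : 0 <= m w. Proof. by case: im. Qed.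

Lemma ord3P (a : 'I_3) : [\/ a = s1, a = s2 | a = s3].
Proof.
case: a => [[|[|[|a]]] h] //; [apply: Or31|apply: Or32|apply: Or33]; exact: val_inj.
Qed.

Lemma sum_ord3 (P' : pred 'I_3) (F : 'I_3 -> R) : \sum_(a | P' a) F a =
  (if P' s1 then F s1 else 0) + ((if P' s2 then F s2 else 0) +
  (if P' s3 then F s3 else 0)).
Proof.
rewrite big_mkcond !big_ord_recl big_ord0 /= addr0.
do !(congr (_ + _)); by congr (if P' _ then F _ else 0); exact: val_inj.
Qed.

Lemma fibre_sum_one v (F : seq _ -> R) :
  fibre_sum p (one :: v) F = fibre_sum p v (fun u => F (s1 :: u)).
Proof.
have e21 : (two == one) = false by [].
by rewrite fibre_sum_cons sum_ord3 p1 p2 p3 eqxx e21 !addr0.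
Qed.

Lemma fibre_sum_two v (F : seq _ -> R) : fibre_sum p (two :: v) F =
  fibre_sum p v (fun u => F (s2 :: u)) + fibre_sum p v (fun u => F (s3 :: u)).
Proof.
have e12 : (one == two) = false by [].
by rewrite fibre_sum_cons sum_ord3 p1 p2 p3 eqxx e12 add0r.
Qed.

Lemma factor_shift_invariant : shift_invariant Y nu.
Proof.
split.
  have mY : measurable (one_block p @^-1` Y).
    rewrite -[X in measurable X]setTI; apply: one_block_measurable => //.
    exact: measurable_sft.
  apply/eqP; rewrite eq_le probability_le1 /=; last exact: measurable_sft.
  have [<- _] := inv; apply: le_measure.
  - by rewrite inE; exact: measurable_sft.
  - by rewrite inE.
  - by move=> x Xx; rewrite /= -piX; exists x.
move=> D mD; have [_ h] := inv.
apply: (h (one_block p @^-1` D)).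
by rewrite -[X in measurable X]setTI; apply: one_block_measurable.
Qed.

Lemma factor_word_gt0 y n : Y y -> 0 < mnu (word y 0 n).
Proof.
rewrite -piX => -[x Xx <-].
rewrite wmeas_distribution /fibre_sum size_word.
have sz : size (word x 0 n) == n by rewrite size_word.
have px : map p (word x 0 n) == word (one_block p x) 0 n.
  by rewrite /word /mkseq -map_comp.
rewrite (bigD1 (Tuple sz)) //=; apply: ltr_wpDr; first exact: sumr_ge0.
exact: (word_gt0 inv C_gt0 gb).
Qed.

Let n_one : mnu [:: one] = m [:: s1].
Proof. by rewrite wmeas_distribution fibre_sum_one fibre_sum_nil. Qed.

Let o0 : 0 < m [:: s1].
Proof. by rewrite -n_one; exact: (m_block_gt0 B12 B21 B22 factor_word_gt0 0). Qed.

Variable l : 'I_3 -> R.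
Hypothesis l_gt0 : forall j, 0 < m [:: j] -> 0 < l j.
Hypothesis l_inv : forall j, \sum_i l i * t i j = l j.
Hypothesis markov : forall a b v, m [:: a, b & v] * l b = l a * t a b * m (b :: v).

Let Q a b := if 0 < m [:: b] then l a * t a b / l b else 0.

Let markovQ a b v : m [:: a, b & v] = Q a b * m (b :: v).
Proof.
rewrite /Q; case: ltP => mb.
  by apply: (mulIf (lt0r_neq0 (l_gt0 mb))); rewrite markov; field; rewrite gt_eqF // l_gt0.
have mb0 : m [:: b] = 0 by apply/le_anti; rewrite mb m0.
apply/le_anti; rewrite mul0r m0 andbT -mb0.
by apply: le_trans (inv_le_catl im [:: a] (b :: v)) _; exact: (inv_le_catr im [:: b]).
Qed.

Let cut u v : m (u ++ s1 :: v) * m [:: s1] = m (rcons u s1) * m (s1 :: v).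
Proof.
elim: u => [|a u IH] /=; first by rewrite mulrC.
have [b [z [z' [E E']]]] : exists b z z', u ++ s1 :: v = b :: z /\ rcons u s1 = b :: z'.
  by case: (u) => [|b u']; [exists s1, v, [::]|exists b, (u' ++ s1 :: v), (rcons u' s1)].
by rewrite E E' !markovQ -E -E' -mulrA IH mulrA.
Qed.

(** As [one] has a single preimage, the Markov property of [mu] at this symbol
    passes to the factor. *)
Lemma factor_renewal w v :
  mnu (w ++ one :: v) * mnu [:: one] = mnu (rcons w one) * mnu (one :: v).
Proof.
rewrite n_one !wmeas_distribution -cats1 !fibre_sum_cat.
have -> : fibre_sum p w (fun u => fibre_sum p [:: one] (fun v => m (u ++ v))) =
    fibre_sum p w (fun u => m (rcons u s1)).
  apply: eq_fibre_sum.
  by move=> u _ _; rewrite fibre_sum_one fibre_sum_nil cats1.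
rewrite -fibre_sumZr -fibre_sumZr; apply: eq_fibre_sum => u _ _.
rewrite !fibre_sum_one -fibre_sumZr -fibre_sumZl; apply: eq_fibre_sum => u' _ _.
exact: cut.
Qed.

Let V i j := fibre_sum p (block j) (fun u => m (i :: u)).

Let block_sum j : mnu (block j.+1) = V s2 j + V s3 j.
Proof. by rewrite wmeas_distribution (fibre_sum_two (block j)). Qed.

Let V0 i : V i 0 = Q i s1 * m [:: s1].
Proof. by rewrite /V (fibre_sum_one [::]) fibre_sum_nil markovQ. Qed.

Let VS i j : V i j.+1 = Q i s2 * V s2 j + Q i s3 * V s3 j.
Proof.
rewrite /V (fibre_sum_two (block j)) -!fibre_sumZl.
by congr (_ + _); apply: eq_fibre_sum => u _ _; rewrite markovQ.
Qed.

Let Q_diag a : Q a a = t a a.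
Proof.
rewrite /Q; case: ltP => ma; first by rewrite mulrAC mulfV ?mul1r // gt_eqF // l_gt0.
rewrite /trans ltNge (le_trans _ ma) //; exact: (inv_le_catr im [:: a] [:: a]).
Qed.

(** By the theorem of Cayley and Hamilton for the transitions between the two
    symbols above [two]. *)
Lemma block_recurrence : exists delta, forall j,
  mnu (block j.+3) = (t s2 s2 + t s3 s3) * mnu (block j.+2) - delta * mnu (block j.+1).
Proof.
exists (t s2 s2 * t s3 s3 - Q s2 s3 * Q s3 s2) => j.
by rewrite !block_sum !VS !Q_diag; ring.
Qed.

Let m_pair i j (x : seq_space 2) : X x -> x 0%N = j -> A i j -> 0 < m [:: i; j].
Proof.
move=> Xx xj Aij; pose y : seq_space 2 := fun h => if h is h'.+1 then x h' else i.
have Xy : X y by case=> [|h] /=; [rewrite xj|exact: Xx].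
by have := word_gt0 inv C_gt0 gb 2 Xy; rewrite !wordS /= xj.
Qed.

Let A_pair i j : 0 < m [:: i; j] -> A i j.
Proof. by case/(gt0_word inv) => x Xx [<- <-]; exact: Xx. Qed.

Lemma trans_gt0 i j : (0 < t i j) = (0 < m [:: i; j]).
Proof. by rewrite /trans; case: ifP; rewrite ?expR_gt0 ?ltxx. Qed.

Let t0 i : t i i = 0 -> A i i = false.
Proof.
move=> ti; apply/negP => Aii; have := trans_gt0 i i.
rewrite ti ltxx => /esym/negP; apply.
by apply: (@m_pair i i (fun=> i)).
Qed.

(** Without the diagonal transitions, the points above the constant sequence
    [two] must alternate between its two preimages. *)
Let alternate : A s2 s2 = false -> A s3 s3 = false ->
  exists x, [/\ X x, x 0%N = s2, x 1%N = s3 & x 2%N = s2].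
Proof.
move=> A22 A33.
have Ytwo : Y (fun=> two) by [].
move: Ytwo; rewrite -piX => -[x Xx px].
have px' i : p (x i) = two by have := congr1 (fun z : seq_space 1 => z i) px.
have next i : (x i = s2 -> x i.+1 = s3) /\ (x i = s3 -> x i.+1 = s2).
  have := Xx i; have := px' i.+1; case: (ord3P (x i.+1)) => -> ; rewrite ?p1 // => _ Ai.
    by split => // xi; rewrite xi A22 in Ai.
  by split => // xi; rewrite xi A33 in Ai.
have [xi0|xi0] : x 0%N = s2 \/ x 0%N = s3.
  by have := px' 0%N; case: (ord3P (x 0%N)) => -> ; rewrite ?p1 //; [left|right].
- exists x; have x1 := (next 0%N).1 xi0; split => //; exact: (next 1%N).2.
- have x1 := (next 0%N).2 xi0; have x2 := (next 1%N).1 x1.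
  exists (shift x); split => //; first exact: (sft_shift 1 Xx).
  exact: (next 2%N).2.
Qed.

Lemma weight_mxE i j : weight_mx A f i j = expR (value2 X f i j) * (A i j)%:R.
Proof. by rewrite mxE. Qed.

Let transM i j : 0 < m [:: j] -> t i j = expR (- P) * weight_mx A f i j.
Proof.
move=> /(gt0_word inv)[x Xx [xj]]; rewrite weight_mxE /trans.
case: ifP => [mij|mij]; first by rewrite (A_pair mij) mulr1 expRD mulrC.
have -> : A i j = false; last by rewrite !mulr0.
by apply/negP => Aij; rewrite (m_pair Xx xj Aij) in mij.
Qed.

(** The trace is the coefficient of the recurrence that decides whether the
    ratios of the measures of runs converge. *)
Lemma trace_eq0_antidiag : t s2 s2 + t s3 s3 = 0 ->
  exists a1 a2, [/\ 0 < a1, 0 < a2 & sub22 (weight_mx A f) = antidiag_mx a1 a2].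
Proof.
have tge0 i j : 0 <= t i j by exact: trans_ge0.
move=> tr; have t22 : t s2 s2 = 0 by have := tge0 s2 s2; have := tge0 s3 s3; lra.
have t33 : t s3 s3 = 0 by have := tge0 s2 s2; have := tge0 s3 s3; lra.
have A22 := t0 t22; have A33 := t0 t33.
have [x [Xx x0 x1 x2]] := alternate A22 A33.
have A23 : A s2 s3 by have := Xx 0%N; rewrite x0 x1.
have A32 : A s3 s2 by have := Xx 1%N; rewrite x1 x2.
exists (weight_mx A f s2 s3), (weight_mx A f s3 s2).
rewrite !weight_mxE A23 A32 !mulr1; split; rewrite ?expR_gt0 //.
have l1 : lift ord0 one = s2 :> 'I_3 by exact: val_inj.
have l2 : lift ord0 two = s3 :> 'I_3 by exact: val_inj.
apply/matrixP => i j; rewrite !mxE.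
case: (ord2P i) => ->; case: (ord2P j) => ->;
  by rewrite ?l1 ?l2 ?A22 ?A33 ?A23 ?A32 ?mulr0 ?mulr1.
Qed.

(** Up to a factor the transitions within the fibre of [two] swap its symbols, and
    their powers alternate.  The alternation does not show in the measures of the
    runs when one of the two vectors that these powers are applied to is symmetric:
    the exit weights to [s1], or the left invariant vector [l], which is symmetric
    when the entrance weights from [s1] are. *)
Lemma antidiag_block_geometric a1 : 0 < a1 ->
  sub22 (weight_mx A f) = antidiag_mx a1 a1 ->
  weight_mx A f s2 s1 = weight_mx A f s3 s1 \/
  weight_mx A f s1 s2 = weight_mx A f s1 s3 ->
  exists2 ka, 0 < ka & forall j, mnu (block j.+2) = ka * mnu (block j.+1).
Proof.
move=> a10 M22 Msym.
have l1 : lift ord0 one = s2 :> 'I_3 by exact: val_inj.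
have l2 : lift ord0 two = s3 :> 'I_3 by exact: val_inj.
have Mij i j : weight_mx A f (lift ord0 i) (lift ord0 j) = antidiag_mx a1 a1 i j.
  by rewrite -M22 !mxE.
have M23 : weight_mx A f s2 s3 = a1 by rewrite -l1 -l2 Mij mxE.
have M32 : weight_mx A f s3 s2 = a1 by rewrite -l1 -l2 Mij mxE.
have M22' : weight_mx A f s2 s2 = 0 by rewrite -l1 Mij mxE.
have M33 : weight_mx A f s3 s3 = 0 by rewrite -l2 Mij mxE.
have Aof i j : A i j = false -> weight_mx A f i j = 0.
  by move=> Aij; rewrite weight_mxE Aij mulr0.
have A22 : A s2 s2 = false.
  apply/negP => h; move/eqP: M22'; rewrite weight_mxE h mulr1.
  by rewrite gt_eqF // ?expR_gt0.
have A33 : A s3 s3 = false.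
  apply/negP => h; move/eqP: M33; rewrite weight_mxE h mulr1.
  by rewrite gt_eqF // ?expR_gt0.
have [x [Xx x0 x1 x2]] := alternate A22 A33.
have live2 : 0 < m [:: s2].
  by have := word_gt0 inv C_gt0 gb 1 Xx; rewrite wordS x0.
have live3 : 0 < m [:: s3].
  by have := word_gt0 inv C_gt0 gb 1 (sft_shift 1 Xx); rewrite wordS /= /shift x1.
have [l1_gt0 l2_gt0 l3_gt0] := And3 (l_gt0 o0) (l_gt0 live2) (l_gt0 live3).
pose ka := expR (- P) * a1.
have ka0 : 0 < ka by rewrite mulr_gt0 ?expR_gt0.
have t22 : t s2 s2 = 0 by rewrite transM // Aof // mulr0.
have t33 : t s3 s3 = 0 by rewrite transM // Aof // mulr0.
have t23 : t s2 s3 = ka by rewrite transM // M23.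
have t32 : t s3 s2 = ka by rewrite transM // M32.
have Q22 : Q s2 s2 = 0 by rewrite Q_diag.
have Q33 : Q s3 s3 = 0 by rewrite Q_diag.
have Q23 : Q s2 s3 = l s2 * ka / l s3 by rewrite /Q live3 t23.
have Q32 : Q s3 s2 = l s3 * ka / l s2 by rewrite /Q live2 t32.
exists ka => // j; rewrite !block_sum.
case: Msym => Msym.
  have prop i : l s3 * V s2 i = l s2 * V s3 i.
    elim: i => [|i IH].
      rewrite !V0 /Q o0 !transM // Msym; ring.
    rewrite !VS Q22 Q33 Q23 Q32; have := IH; move: (V s2 i) (V s3 i) => a b ab.
    transitivity (ka * (l s2 * b)); first by field; rewrite gt_eqF.
    by rewrite -ab; field; rewrite gt_eqF.
  rewrite !VS Q22 Q33 Q23 Q32; have := prop j; move: (V s2 j) (V s3 j) => a b ab.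
  transitivity (ka * ((l s2 * b) / l s3 + (l s3 * a) / l s2)).
    by field; rewrite !gt_eqF.
  have -> : l s2 * b / l s3 = a by rewrite -ab; field; rewrite gt_eqF.
  have -> : l s3 * a / l s2 = b by rewrite ab; field; rewrite gt_eqF.
  by ring.
have l23 : l s2 = l s3.
  have := l_inv s2; have := l_inv s3; rewrite !(sum_ord3 predT) /= t22 t33 t23 t32.
  rewrite !transM // Msym !mulr0 !add0r !addr0.
  set u := l s1 * _ => h3 h2.
  have : (1 + ka) * (l s2 - l s3) = 0 by lra.
  move/eqP; rewrite mulf_eq0 subr_eq0 gt_eqF ?addr_gt0 //= => /eqP //.
by rewrite !VS Q22 Q33 Q23 Q32 l23; field; rewrite gt_eqF.
Qed.

End Factor.

Theorem theorem4p2 (R : realType) (A : 'M[bool]_3) (B : 'M[bool]_2)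
    (p : 'I_3 -> 'I_2) (f : seq_space 2 -> R)
    (mu : probability (seq_space 2) R) :
  let X := sft A in
  let Y := sft B in
  let s1 : 'I_3 := @Ordinal 3 0 isT in
  let s2 : 'I_3 := @Ordinal 3 1 isT in
  let s3 : 'I_3 := @Ordinal 3 2 isT in
  let t1 : 'I_2 := @Ordinal 2 0 isT in
  let t2 : 'I_2 := @Ordinal 2 1 isT in
  let g := relative_g X p f in
  let pimu : probability (seq_space 1) R := distribution mu (one_block p) in
  let M := weight_mx A f in
  let M22 := sub22 M in
  irreducible X -> irreducible Y ->
  Y = setT \/ B = golden_mx ->
  factor_map X Y (one_block p) ->
  p s1 = t1 -> p s2 = t2 -> p s3 = t2 ->
  two_coordinates X f ->
  shift_invariant X mu -> gibbs X f mu ->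
  [/\ gibbs_assertion Y g pimu (fun h => measurable_fun Y h),
      (~ exists a1 a2, [/\ 0 < a1, 0 < a2 & M22 = antidiag_mx a1 a2]) ->
        gibbs_assertion Y g pimu (fun h => {within Y, continuous h}) &
      (exists2 a1, 0 < a1 & M22 = antidiag_mx a1 a1) ->
      M s2 s1 = M s3 s1 \/ M s1 s2 = M s1 s3 ->
        gibbs_assertion Y g pimu (fun h => {within Y, continuous h})].
Proof.
move=> X Y s1 s2 s3 t1 t2 g pimu M M22 _ _ HY [_ piX _] p1 p2 p3 f2 inv [P [C [C0 gb]]].
have [B12 [B21 B22]] : B t1 t2 /\ B t2 t1 /\ B t2 t2.
  case: HY => [YT|->]; last by rewrite !mxE.
  have YB (y : seq_space 1) : forall n, B (y n) (y n.+1).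
    by have : Y y by rewrite YT.
  split; first exact: (YB (fun i => if i is 0%N then t1 else t2) 0%N).
  split; last exact: (YB (fun=> t2) 0%N).
  exact: (YB (fun i => if i is 0%N then t2 else t1) 0%N).
have [l [lpos linv mk]] := gibbs_markov f2 inv C0 gb.
have invn : shift_invariant Y pimu by exact: factor_shift_invariant piX inv.
have npos := factor_word_gt0 piX inv C0 gb.
have ren := factor_renewal p1 p2 p3 inv lpos mk.
have g_bounds y n : Y y -> (0 < n)%N ->
    C^-1 * (expR (n%:R * P) * wmeas pimu (word y 0 n)) <= g n y <=
    C * (expR (n%:R * P) * wmeas pimu (word y 0 n)).
  by move=> _ n0; rewrite wmeas_distribution; exact: relative_g_bounds inv C0 gb _ _ n0.
have g_cont : positive_continuous Y g.
  move=> n n0; split.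
    apply: cylinder_within_continuous => y _; exists n => y' _.
    exact: relative_g_word.
  move=> y Yy; have /andP[+ _] := g_bounds y n Yy n0; apply: lt_le_trans.
  by rewrite !mulr_gt0 ?invr_gt0 ?expR_gt0 // npos.
have assertion := factor_assertion B12 B21 B22 invn npos ren g_cont C0 g_bounds.
have b0 := m_block_gt0 B12 B21 B22 npos.
pose e j := wmeas pimu (block j.+1).
have e0 j : 0 < e j by exact: b0.
have [delta rec] := block_recurrence p1 p2 p3 inv lpos mk.
set tau := _ + _ in rec.
have tau0 : 0 <= tau by rewrite addr_ge0 // trans_ge0.
have from_ratio C' : quasi_bernoulli Y (wmeas pimu) C' ->
    forall theta, (fun j => e j.+1 / e j) @ \oo --> theta ->
    [/\ 0 < theta < 1, quasi_geometric e theta 1 &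
        {within Y, continuous (factor_potential pimu theta)}].
  move=> qb theta et.
  have [lo [hi [lo0 hi1 eb]]] := block_ratio_bounds B12 B21 B22 invn npos qb.
  have /andP[loth thhi] : lo <= theta <= hi.
    apply/andP; split.
      apply: (ler_cvg_to (@cvg_cst _ lo _ \oo _) et); apply: nearW => j.
      by have /andP[] := eb j.
    apply: (ler_cvg_to et (@cvg_cst _ hi _ \oo _)); apply: nearW => j.
    by have /andP[] := eb j.
  have t01 : 0 < theta < 1.
    by rewrite (lt_le_trans lo0 loth) (le_lt_trans thhi hi1).
  split => //.
    by apply: ratio_cvg_quasi_geometric => //; case/andP: t01.
  exact: continuous_factor_potential (wmeas_invariant invn) b0 t01 et Y.
have ratio_of_trace C' : quasi_bernoulli Y (wmeas pimu) C' -> 0 < tau ->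
    exists theta : R, (fun j => e j.+1 / e j) @ \oo --> theta.
  move=> qb tau1.
  have [lo [hi [lo0 _ eb]]] := block_ratio_bounds B12 B21 B22 invn npos qb.
  have [theta _ et] := recurrence_ratio_cvg e0 rec tau1 lo0 eb.
  by exists theta.
split.
- apply: assertion => C' qb; have [tau1|tau1] := ltP 0 tau.
    have [theta et] := ratio_of_trace C' qb tau1.
    have [t01 qg _] := from_ratio C' qb theta et.
    exists theta, 1; split => //.
    by apply: measurable_factor_potential; exact: measurable_sft.
  have tau_eq0 : tau = 0 by apply/le_anti; rewrite tau1 tau0.
  have rec2 j : e j.+2 = - delta * e j by rewrite /e rec tau_eq0 mul0r sub0r mulNr.
  have rho0 : 0 < - delta by rewrite -(pmulr_lgt0 _ (e0 0%N)) -rec2.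
  have [lo [hi [lo0 hi1 eb]]] := block_ratio_bounds B12 B21 B22 invn npos qb.
  have rho1 : - delta < 1.
    have e_lt j : e j.+1 < e j.
      have /andP[_ h] := eb j; rewrite -[ltRHS]mul1r -ltr_pdivrMr //.
      exact: le_lt_trans h hi1.
    by rewrite -(ltr_pM2r (e0 0%N)) -rec2 mul1r (lt_trans (e_lt 1%N)).
  have s0 : 0 < Num.sqrt (- delta) by rewrite sqrtr_gt0.
  exists (Num.sqrt (- delta)), `|ln (e 1%N / e 0%N) - ln (Num.sqrt (- delta))|; split.
  + by rewrite s0 /= -sqrtr1 ltr_sqrt.
  + by apply: period2_quasi_geometric => // j; rewrite sqr_sqrtr ?(ltW rho0) //; exact: rec2.
  + by apply: measurable_factor_potential; exact: measurable_sft.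
- move=> not_antidiag; apply: assertion => C' qb.
  have tau1 : 0 < tau.
    rewrite lt_def tau0 andbT; apply/eqP => tau_eq0; apply: not_antidiag.
    exact: trace_eq0_antidiag piX p1 B22 inv C0 gb tau_eq0.
  have [theta et] := ratio_of_trace C' qb tau1.
  by exists theta, 1; exact: from_ratio C' qb theta et.
- move=> [a1 a10 M22E] Msym; apply: assertion => C' qb.
  have [ka ka0 e_ka] := antidiag_block_geometric piX p1 p2 p3 B12 B21 B22 inv C0 gb
    lpos linv mk a10 M22E Msym.
  exists ka, 1; apply: (from_ratio C' qb ka).
  rewrite (_ : (fun j => e j.+1 / e j) = fun=> ka); first exact: cvg_cst.
  by apply/funext => j; rewrite /e e_ka mulfK // gt_eqF.
Qed.
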